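(* Let $k$ be a field, let $A$ and $B$ be finite-dimensional $k$-algebras such that $B$ has finite global dimension, and let $\Lambda=A\otimes_k B$. Then: (1) $\Lambda$ is left weakly Gorenstein if and only if $A$ is left weakly Gorenstein. (2) If $A$ is left weakly Gorenstein, then ${}^\perp\Lambda=\operatorname{Mon}(B,{}^\perp A)$. (3) If $B$ is not semisimple, then the converse of (2) also holds: if ${}^\perp\Lambda=\operatorname{Mon}(B,{}^\perp A)$, then $A$ is left weakly Gorenstein.
   Context: All modules are finitely generated and $\otimes=\otimes_k$. For an Artin algebra $R$, a left $R$-module $M$ is semi-Gorenstein-projective if $\operatorname{Ext}^i_R(M,R)=0$ for all $i\ge 1$; ${}^\perp R$ is the full subcategory of finitely generated left $R$-modules consisting of the semi-Gorenstein-projective ones. A left $R$-module $G$ is Gorenstein-projective if there is an acyclic complex $P^\bullet:\cdots\to P^{-1}\to P^0\xrightarrow{d_0}P^1\to\cdots$ of finitely generated projective left $R$-modules such that $\operatorname{Hom}_R(P^\bullet,P)$ is acyclic for every finitely generated projective $P$, and $G\cong\operatorname{Ker}d_0$. The algebra $R$ is left weakly Gorenstein if every semi-Gorenstein-projective left $R$-module is Gorenstein-projective. A left $\Lambda$-module $M$ is a monic representation of $B$ over $A$ if one of the following equivalent conditions holds: (i) $\operatorname{Tor}^\Lambda_i(A\otimes Y,M)=0$ for all $i\ge1$ and each right $B$-module $Y$; (ii) $\operatorname{Ext}^i_\Lambda(M,D(A)\otimes X)=0$ for all $i\ge 1$ and each left $B$-module $X$, where $D=\operatorname{Hom}_k(-,k)$;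 (iii) $M$ is projective as a left $B$-module. $\operatorname{Mon}(B,A)$ is the full subcategory of such modules. For a full additive subcategory $\mathcal L$ of the category of finitely generated left $A$-modules, $$\operatorname{Mon}(B,\mathcal L)=\{M\in\operatorname{Mon}(B,A)\mid (A\otimes Y)\otimes_\Lambda M\in\mathcal L\ \text{ for every finitely generated right } B\text{-module } Y\}.$$ *)

(* Defs.v *)
From HB Require Import structures.
From mathcomp Require Import all_boot all_order all_algebra all_field.
From mathcomp Require Import boolp.

Set Implicit Arguments.
Unset Strict Implicit.
Unset Printing Implicit Defensive.

Import GRing.Theory.

Local Open Scope ring_scope.
Local Open Scope quotient_scope.

(* The abelian group U (x) V / (r i u (x) v = u (x) l i v, for all i : I).
   With I a commutative ring acting on U and V this is the tensor product over
   that ring; with I a ring acting on U on the right through r and on V on the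
   left through l, it is the tensor product of a right and a left I-module.
   Its elements are formal sums of pure tensors, two sums being identified when
   no biadditive balanced map distinguishes them; see tens_liftE,
   tens_liftD and tens_ext for the universal property. *)

Section Tensor.
Variables (I : Type) (U V : zmodType) (r : I -> U -> U) (l : I -> V -> V).

Record balanced (Z : zmodType) (f : U -> V -> Z) : Prop := Balanced {
  balDl : forall u u' v, f (u + u') v = f u v + f u' v;
  balDr : forall u v v', f u (v + v') = f u v + f u v';
  balM : forall i u v, f (r i u) v = f u (l i v) }.

Definition tsum (Z : zmodType) (f : U -> V -> Z) (s : seq (U * V)) : Z :=
  \sum_(p <- s) f p.1 p.2.

Definition tens_rel (s s' : seq (U * V)) : bool :=
  `[< forall (Z : zmodType) (f : U -> V -> Z),
        balanced f -> tsum f s = tsum f s' >].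

Lemma tens_rel_refl : reflexive tens_rel.
Proof. by move=> s; apply/asboolP. Qed.

Lemma tens_rel_sym : symmetric tens_rel.
Proof.
by move=> s s'; apply/asboolP/asboolP => e Z f hf; rewrite (e Z f hf).
Qed.

Lemma tens_rel_trans : transitive tens_rel.
Proof.
move=> s' s s'' /asboolP e /asboolP e'; apply/asboolP => Z f hf.
by rewrite (e Z f hf) (e' Z f hf).
Qed.

Canonical tens_equiv :=
  EquivRel tens_rel tens_rel_refl tens_rel_sym tens_rel_trans.

Definition tens : Type := {eq_quot tens_equiv}.
HB.instance Definition _ := Choice.on tens.
HB.instance Definition _ := EqQuotient.on tens.

Definition tens_lift (Z : zmodType) (f : U -> V -> Z) (x : tens) : Z :=
  tsum f (repr x).

Definition pure (u : U) (v : V) : tens := \pi_tens [:: (u, v)].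

Lemma tens_lift_pi Z f s : @balanced Z f -> tens_lift f (\pi_tens s) = tsum f s.
Proof.
move=> hf; rewrite /tens_lift; have: repr (\pi_tens s) = s %[mod tens].
  by rewrite reprK.
by move/eqmodP/asboolP => ->.
Qed.

Lemma tens_eqP (x y : tens) :
  (forall (Z : zmodType) (f : U -> V -> Z),
     balanced f -> tens_lift f x = tens_lift f y) -> x = y.
Proof.
move=> h; rewrite -[x]reprK -[y]reprK; apply/eqmodP/asboolP => Z f hf.
exact: h.
Qed.

Definition tens0 : tens := \pi_tens [::].
Definition tens_add (x y : tens) : tens := \pi_tens (repr x ++ repr y).
Definition tens_opp (x : tens) : tens :=
  \pi_tens [seq (- p.1, p.2) | p <- repr x].

Lemma balNl Z f : @balanced Z f -> forall u v, f (- u) v = - f u v.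
Proof.
move=> hf u v; have f0 : f 0 v = 0.
  by apply: (addrI (f 0 v)); rewrite -(balDl hf) !addr0.
by apply: (addrI (f u v)); rewrite -(balDl hf) !subrr.
Qed.

Lemma tens_lift0 Z f : @balanced Z f -> tens_lift f tens0 = 0.
Proof. by move=> hf; rewrite tens_lift_pi // /tsum big_nil. Qed.

Lemma tens_lift_add Z f : @balanced Z f ->
  {morph tens_lift f : x y / tens_add x y >-> x + y}.
Proof. by move=> hf x y; rewrite tens_lift_pi // /tsum big_cat. Qed.

Lemma tens_lift_opp Z f : @balanced Z f ->
  {morph tens_lift f : x / tens_opp x >-> - x}.
Proof.
move=> hf x; rewrite tens_lift_pi // /tsum big_map -sumrN.
by apply: eq_bigr => p _; rewrite (balNl hf).
Qed.

Lemma tens_addA : associative tens_add.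
Proof.
by move=> x y z; apply: tens_eqP => Z f hf; rewrite !tens_lift_add // addrA.
Qed.

Lemma tens_addC : commutative tens_add.
Proof.
by move=> x y; apply: tens_eqP => Z f hf; rewrite !tens_lift_add // addrC.
Qed.

Lemma tens_add0 : left_id tens0 tens_add.
Proof.
move=> x; apply: tens_eqP => Z f hf.
by rewrite tens_lift_add // tens_lift0 // add0r.
Qed.

Lemma tens_addN : left_inverse tens0 tens_opp tens_add.
Proof.
move=> x; apply: tens_eqP => Z f hf.
by rewrite tens_lift_add // tens_lift_opp // tens_lift0 // addNr.
Qed.

HB.instance Definition _ :=
  GRing.isZmodule.Build tens tens_addA tens_addC tens_add0 tens_addN.

Lemma tens_liftD Z f : @balanced Z f -> {morph tens_lift f : x y / x + y}.
Proof. exact: tens_lift_add. Qed.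

Lemma tens_liftE Z f u v : @balanced Z f -> tens_lift f (pure u v) = f u v.
Proof. by move=> hf; rewrite tens_lift_pi // /tsum big_seq1. Qed.

Lemma pure_balanced : balanced pure.
Proof.
split=> *; apply: tens_eqP => Z f hf.
- by rewrite tens_liftD // !tens_liftE // (balDl hf).
- by rewrite tens_liftD // !tens_liftE // (balDr hf).
- by rewrite !tens_liftE // (balM hf).
Qed.

Lemma pureDl u u' v : pure (u + u') v = pure u v + pure u' v.
Proof. exact: (balDl pure_balanced). Qed.
Lemma pureDr u v v' : pure u (v + v') = pure u v + pure u v'.
Proof. exact: (balDr pure_balanced). Qed.
Lemma pureM i u v : pure (r i u) v = pure u (l i v).
Proof. exact: (balM pure_balanced). Qed.

Lemma tens_ind (P : tens -> Prop) : (forall u v, P (pure u v)) ->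
  (forall x y, P x -> P y -> P (x + y)) -> forall x, P x.
Proof.
move=> Pp PD x.
have P0 : P 0.
  suff -> : 0 = pure 0 0 by [].
  by apply: (addrI (pure 0 0)); rewrite -pureDl !addr0.
have -> : x = \sum_(p <- repr x) pure p.1 p.2.
  apply: tens_eqP => Z f hf; rewrite {1}/tens_lift /tsum.
  elim: (repr x) => [|p s IHs]; first by rewrite !big_nil tens_lift0.
  by rewrite !big_cons tens_liftD // tens_liftE // IHs.
by elim: (repr x) => [|p s IHs]; rewrite ?big_nil ?big_cons //; apply: PD.
Qed.

Lemma tens_ext (Z : zmodType) (g h : tens -> Z) :
  {morph g : x y / x + y} -> {morph h : x y / x + y} ->
  (forall u v, g (pure u v) = h (pure u v)) -> g =1 h.
Proof.
by move=> gD hD e; apply: tens_ind => // x y ex ey; rewrite gD hD ex ey.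
Qed.

End Tensor.

Section TensorAlgebra.
Variables (k : fieldType) (A B : falgType k).

Definition tensalg : Type :=
  tens (fun (c : k) (a : A) => c *: a) (fun (c : k) (b : B) => c *: b).
HB.instance Definition _ := GRing.Zmodule.on tensalg.

Definition tpure (a : A) (b : B) : tensalg := pure _ _ a b.

Lemma tpureDl a a' b : tpure (a + a') b = tpure a b + tpure a' b.
Proof. exact: pureDl. Qed.
Lemma tpureDr a b b' : tpure a (b + b') = tpure a b + tpure a b'.
Proof. exact: pureDr. Qed.
Lemma tpureZ c a b : tpure (c *: a) b = tpure a (c *: b).
Proof. exact: (@pureM _ _ _ _ _ c). Qed.

Lemma tensalg_ind (P : tensalg -> Prop) : (forall a b, P (tpure a b)) ->
  (forall x y, P x -> P y -> P (x + y)) -> forall x, P x.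
Proof. exact: tens_ind. Qed.

(* (a (x) b)(a' (x) b') = aa' (x) bb' *)
Definition tmul (x y : tensalg) : tensalg :=
  tens_lift (fun a b => tens_lift (fun a' b' => tpure (a * a') (b * b')) y) x.

Lemma tmul_bal1 a b :
  balanced (fun (c : k) (a : A) => c *: a) (fun (c : k) (b : B) => c *: b)
    (fun a' b' => tpure (a * a') (b * b')).
Proof.
split=> *; rewrite ?mulrDr ?tpureDl ?tpureDr //.
by rewrite -!scalerAr tpureZ.
Qed.

Lemma tmul_bal2 (y : tensalg) :
  balanced (fun (c : k) (a : A) => c *: a) (fun (c : k) (b : B) => c *: b)
    (fun a b => tens_lift (fun a' b' => tpure (a * a') (b * b')) y : tensalg).
Proof.
split; elim/tensalg_ind: y => [a' b'|y y' IHy IHy'] *.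
- by rewrite !(tens_liftE _ _ (tmul_bal1 _ _)) mulrDl tpureDl.
- by rewrite !(tens_liftD (tmul_bal1 _ _)) IHy IHy' addrACA.
- by rewrite !(tens_liftE _ _ (tmul_bal1 _ _)) mulrDl tpureDr.
- by rewrite !(tens_liftD (tmul_bal1 _ _)) IHy IHy' addrACA.
- by rewrite !(tens_liftE _ _ (tmul_bal1 _ _)) -!scalerAl tpureZ.
- by rewrite !(tens_liftD (tmul_bal1 _ _)) IHy IHy'.
Qed.

Lemma tmulE a b a' b' :
  tmul (tpure a b) (tpure a' b') = tpure (a * a') (b * b').
Proof.
by rewrite /tmul (tens_liftE _ _ (tmul_bal2 _)) (tens_liftE _ _ (tmul_bal1 _ _)).
Qed.

Lemma tmulDl : left_distributive tmul +%R.
Proof. by move=> x x' y; rewrite /tmul (tens_liftD (tmul_bal2 _)). Qed.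

Lemma tmulDr : right_distributive tmul +%R.
Proof.
move=> x y y'; elim/tensalg_ind: x => [a b|x x' IHx IHx'].
  by rewrite /tmul !(tens_liftE _ _ (tmul_bal2 _)) (tens_liftD (tmul_bal1 _ _)).
by rewrite !tmulDl IHx IHx' addrACA.
Qed.

Lemma tmulA : associative tmul.
Proof.
move=> x y z; elim/tensalg_ind: x => [a b|? ? IH1 IH2]; last first.
  by rewrite !tmulDl IH1 IH2.
elim/tensalg_ind: y => [a' b'|? ? IH1 IH2]; last first.
  by rewrite !(tmulDl, tmulDr) IH1 IH2.
elim/tensalg_ind: z => [a'' b''|? ? IH1 IH2]; last first.
  by rewrite !tmulDr IH1 IH2.
by rewrite !tmulE !mulrA.
Qed.

Lemma tmul1l : left_id (tpure 1 1) tmul.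
Proof.
move=> x; elim/tensalg_ind: x => [a b|? ? IH1 IH2]; last by rewrite tmulDr IH1 IH2.
by rewrite tmulE !mul1r.
Qed.

Lemma tmul1r : right_id (tpure 1 1) tmul.
Proof.
move=> x; elim/tensalg_ind: x => [a b|? ? IH1 IH2]; last by rewrite tmulDl IH1 IH2.
by rewrite tmulE !mulr1.
Qed.

HB.instance Definition _ :=
  GRing.Zmodule_isPzRing.Build tensalg tmulA tmul1l tmul1r tmulDl tmulDr.

Lemma tpureM a b a' b' : tpure a b * tpure a' b' = tpure (a * a') (b * b').
Proof. exact: tmulE. Qed.

Lemma tens1_neq0 : 1 != 0 :> tensalg.
Proof.
have nz (C : falgType k) :
    exists i, coord (vbasis {:C}) i (1 : C) != 0.
  apply/existsP; apply: contraNT (oner_neq0 C) => /existsPn h.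
  rewrite (coord_vbasis (memvf (1 : C))) big1 // => i _.
  by have /negPn/eqP -> := h i; rewrite scale0r.
have [[i hi] [j hj]] := (nz A, nz B).
pose f (a : A) (b : B) : k :=
  coord (vbasis {:A}) i a * coord (vbasis {:B}) j b.
have hf : balanced (fun (c : k) (a : A) => c *: a)
    (fun (c : k) (b : B) => c *: b) f.
  split=> *; rewrite /f ?(linearD, linearZ) /= ?mulrDl ?mulrDr //.
  by rewrite mulrCA mulrA.
apply/eqP => /(congr1 (tens_lift f)); rewrite (tens_lift0 hf) (tens_liftE _ _ hf).
by move/eqP; rewrite mulf_eq0 (negPf hi) (negPf hj).
Qed.

HB.instance Definition _ :=
  GRing.PzSemiRing_isNonZero.Build tensalg tens1_neq0.

Definition tscale (c : k) (x : tensalg) : tensalg := tpure c%:A 1 * x.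

Lemma tscaleE c a b : tscale c (tpure a b) = tpure (c *: a) b.
Proof. by rewrite /tscale tpureM -scalerAl !mul1r. Qed.

Lemma tscaleA c c' x : tscale c (tscale c' x) = tscale (c * c') x.
Proof. by rewrite /tscale mulrA tpureM mulr1 -scalerAl mul1r scalerA. Qed.
Lemma tscale1 : left_id 1 tscale.
Proof. by move=> x; rewrite /tscale scale1r mul1r. Qed.
Lemma tscaleDr : right_distributive tscale +%R.
Proof. by move=> c x y; rewrite /tscale mulrDr. Qed.
Lemma tscaleDl x : {morph tscale^~ x : c c' / c + c'}.
Proof. by move=> c c'; rewrite /tscale scalerDl tpureDl mulrDl. Qed.

HB.instance Definition _ := GRing.Zmodule_isLmodule.Build k tensalg
  tscaleA tscale1 tscaleDr tscaleDl.

Lemma tscaleAl c (x y : tensalg) : c *: (x * y) = (c *: x) * y.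
Proof. exact: mulrA. Qed.

HB.instance Definition _ := GRing.Lmodule_isLalgebra.Build k tensalg tscaleAl.

Lemma tscaleAr c (x y : tensalg) : c *: (x * y) = x * (c *: y).
Proof.
rewrite /(_ *: _) /= /tscale !mulrA; congr (_ * y).
elim/tensalg_ind: x => [a b|? ? IH1 IH2]; last by rewrite mulrDl mulrDr IH1 IH2.
by rewrite !tpureM -scalerAl -scalerAr !mul1r !mulr1.
Qed.

HB.instance Definition _ := GRing.LSemiAlgebra_isSemiAlgebra.Build k tensalg tscaleAr.

Definition tensr (b : B) : tensalg := tpure 1 b.

Lemma tensr_is_zmod_morphism : zmod_morphism tensr.
Proof.
move=> b b'; rewrite /tensr; apply: (addIr (tpure 1 b')).
by rewrite subrK -tpureDr subrK.
Qed.

Lemma tensr_is_monoid_morphism : monoid_morphism tensr.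
Proof. by split=> // b b'; rewrite tpureM mulr1. Qed.

HB.instance Definition _ :=
  GRing.isZmodMorphism.Build B tensalg tensr tensr_is_zmod_morphism.
HB.instance Definition _ :=
  GRing.isMonoidMorphism.Build B tensalg tensr tensr_is_monoid_morphism.

End TensorAlgebra.

(* A right R-module is a left module over the converse ring R^c. *)

Section TensorModule.
Variables (k : fieldType) (A B : falgType k) (Y : lmodType B^c).

Definition ract (y : Y) (b : B) : Y := (b : B^c) *: y.

Lemma ractDl y y' b : ract (y + y') b = ract y b + ract y' b.
Proof. exact: scalerDr. Qed.
Lemma ractDr y b b' : ract y (b + b') = ract y b + ract y b'.
Proof. exact: scalerDl. Qed.
Lemma ractA y b b' : ract (ract y b) b' = ract y (b * b').
Proof. exact: scalerA. Qed.
Lemma ract1 y : ract y 1 = y.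
Proof. exact: scale1r. Qed.

(* k acts on Y through the structure map of B. *)
Definition kact (c : k) (y : Y) : Y := ract y c%:A.

Definition tensmod : Type := tens (fun (c : k) (a : A) => c *: a) kact.
HB.instance Definition _ := GRing.Zmodule.on tensmod.

Definition mpure (a : A) (y : Y) : tensmod := pure _ _ a y.

Lemma mpureDl a a' y : mpure (a + a') y = mpure a y + mpure a' y.
Proof. exact: pureDl. Qed.
Lemma mpureDr a y y' : mpure a (y + y') = mpure a y + mpure a y'.
Proof. exact: pureDr. Qed.
Lemma mpureZ c a y : mpure (c *: a) y = mpure a (kact c y).
Proof. exact: (@pureM _ _ _ _ _ c). Qed.

Lemma tensmod_ind (P : tensmod -> Prop) : (forall a y, P (mpure a y)) ->
  (forall u v, P u -> P v -> P (u + v)) -> forall u, P u.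
Proof. exact: tens_ind. Qed.

(* a' . (a (x) y) = a'a (x) y *)
Definition mleft (a' : A) (u : tensmod) : tensmod :=
  tens_lift (fun a y => mpure (a' * a) y) u.

Lemma mleft_bal a' :
  balanced (fun (c : k) (a : A) => c *: a) kact
    (fun a y => mpure (a' * a) y).
Proof.
split=> *; rewrite ?mulrDr ?mpureDl ?mpureDr //.
by rewrite -scalerAr mpureZ.
Qed.

Lemma mleftE a' a y : mleft a' (mpure a y) = mpure (a' * a) y.
Proof. exact: (tens_liftE _ _ (mleft_bal a')). Qed.

Lemma mleftD a : {morph mleft a : u v / u + v}.
Proof. exact: (tens_liftD (mleft_bal a)). Qed.

Lemma mleftDl a a' u : mleft (a + a') u = mleft a u + mleft a' u.
Proof.
elim/tensmod_ind: u => [b y|u v IHu IHv]; last by rewrite !mleftD IHu IHv addrACA.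
by rewrite !mleftE mulrDl mpureDl.
Qed.

Lemma mleftM a a' u : mleft (a * a') u = mleft a (mleft a' u).
Proof.
elim/tensmod_ind: u => [b y|u v IHu IHv]; last by rewrite !mleftD IHu IHv.
by rewrite !mleftE mulrA.
Qed.

Lemma mleft1 u : mleft 1 u = u.
Proof.
elim/tensmod_ind: u => [b y|u v IHu IHv]; last by rewrite !mleftD IHu IHv.
by rewrite mleftE mul1r.
Qed.

(* (a (x) y) . (a' (x) b) = aa' (x) yb *)
Definition mright (u : tensmod) (x : tensalg A B) : tensmod :=
  tens_lift (fun a y =>
    tens_lift (fun a' b => mpure (a * a') (ract y b)) x) u.

Lemma mright_bal1 a y :
  balanced (fun (c : k) (a : A) => c *: a) (fun (c : k) (b : B) => c *: b)
    (fun a' b => mpure (a * a') (ract y b)).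
Proof.
split=> *; rewrite ?mulrDr ?ractDr ?mpureDl ?mpureDr //.
rewrite -scalerAr mpureZ /kact ractA.
by rewrite -scalerAr mulr1.
Qed.

Lemma mright_bal2 (x : tensalg A B) :
  balanced (fun (c : k) (a : A) => c *: a) kact
    (fun a y => tens_lift (fun a' b => mpure (a * a') (ract y b)) x : tensmod).
Proof.
split; elim/tensalg_ind: x => [a' b'|x x' IHx IHx'] *.
- by rewrite !(tens_liftE _ _ (mright_bal1 _ _)) mulrDl mpureDl.
- by rewrite !(tens_liftD (mright_bal1 _ _)) IHx IHx' addrACA.
- by rewrite !(tens_liftE _ _ (mright_bal1 _ _)) ractDl mpureDr.
- by rewrite !(tens_liftD (mright_bal1 _ _)) IHx IHx' addrACA.
- rewrite !(tens_liftE _ _ (mright_bal1 _ _)) -scalerAl mpureZ /kact !ractA.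
  by rewrite -scalerAr -scalerAl mul1r mulr1.
- by rewrite !(tens_liftD (mright_bal1 _ _)) IHx IHx'.
Qed.

Lemma mrightE a y a' b :
  mright (mpure a y) (tpure a' b) = mpure (a * a') (ract y b).
Proof.
by rewrite /mright (tens_liftE _ _ (mright_bal2 _)) (tens_liftE _ _ (mright_bal1 _ _)).
Qed.

Lemma mrightDl u v x : mright (u + v) x = mright u x + mright v x.
Proof. by rewrite /mright (tens_liftD (mright_bal2 _)). Qed.

Lemma mrightDr u x x' : mright u (x + x') = mright u x + mright u x'.
Proof.
elim/tensmod_ind: u => [a y|u v IHu IHv].
  by rewrite /mright !(tens_liftE _ _ (mright_bal2 _)) (tens_liftD (mright_bal1 _ _)).
by rewrite !mrightDl IHu IHv addrACA.
Qed.

Lemma mrightM u x x' : mright u (x * x') = mright (mright u x) x'.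
Proof.
elim/tensmod_ind: u => [a y|? ? IH1 IH2]; last by rewrite !mrightDl IH1 IH2.
elim/tensalg_ind: x => [a' b'|? ? IH1 IH2]; last first.
  by rewrite mulrDl !mrightDr mrightDl IH1 IH2.
elim/tensalg_ind: x' => [a'' b''|? ? IH1 IH2]; last first.
  by rewrite mulrDr !mrightDr IH1 IH2.
by rewrite tpureM !mrightE ractA mulrA.
Qed.

Lemma mright1 u : mright u 1 = u.
Proof.
elim/tensmod_ind: u => [a y|? ? IH1 IH2]; last by rewrite !mrightDl IH1 IH2.
by rewrite mrightE mulr1 ract1.
Qed.

Lemma mleft_mright a u x : mleft a (mright u x) = mright (mleft a u) x.
Proof.
elim/tensmod_ind: u => [a' y|? ? IH1 IH2]; last first.
  by rewrite !(mrightDl, mleftD) IH1 IH2.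
elim/tensalg_ind: x => [a'' b''|? ? IH1 IH2]; last first.
  by rewrite !(mrightDr, mleftD) IH1 IH2.
by rewrite mrightE !mleftE mrightE mulrA.
Qed.

Definition mscale (x : (tensalg A B)^c) (u : tensmod) : tensmod := mright u x.

Lemma mscaleA x x' u : mscale x (mscale x' u) = mscale (x * x') u.
Proof. by rewrite /mscale -mrightM. Qed.
Lemma mscale1 : left_id 1 mscale.
Proof. exact: mright1. Qed.
Lemma mscaleDr : right_distributive mscale +%R.
Proof. by move=> x u v; apply: mrightDl. Qed.
Lemma mscaleDl u : {morph mscale^~ u : x x' / x + x'}.
Proof. exact: mrightDr. Qed.

HB.instance Definition _ := GRing.Zmodule_isLmodule.Build (tensalg A B)^c tensmod
  mscaleA mscale1 mscaleDr mscaleDl.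

End TensorModule.

Section TensorOver.
Variables (k : fieldType) (A B : falgType k).
Variables (Y : lmodType B^c) (M : lmodType (tensalg A B)).

Let rL (x : tensalg A B) (u : tensmod A Y) : tensmod A Y :=
  (x : (tensalg A B)^c) *: u.
Let lL (x : tensalg A B) (m : M) : M := x *: m.

Definition tensover : Type := tens rL lL.
HB.instance Definition _ := GRing.Zmodule.on tensover.

Definition opure (u : tensmod A Y) (m : M) : tensover := pure _ _ u m.

(* a . (u (x) m) = au (x) m *)
Definition oscale (a : A) (t : tensover) : tensover :=
  tens_lift (fun u m => opure (mleft a u) m) t.

Lemma oscale_bal a : balanced rL lL (fun u m => opure (mleft a u) m).
Proof.
split=> *; rewrite ?mleftD ?[LHS]pureDl ?[LHS]pureDr //.
by rewrite /rL [_ *: _ in LHS]/(_ *: _) /= /mscale mleft_mright [LHS]pureM.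
Qed.

Lemma oscaleE a u m : oscale a (opure u m) = opure (mleft a u) m.
Proof. exact: (tens_liftE _ _ (oscale_bal a)). Qed.

Lemma oscaleDr : right_distributive oscale +%R.
Proof. by move=> a; apply: (tens_liftD (oscale_bal a)). Qed.

Lemma tensover_ind (P : tensover -> Prop) : (forall u m, P (opure u m)) ->
  (forall s t, P s -> P t -> P (s + t)) -> forall t, P t.
Proof. exact: tens_ind. Qed.

Lemma oscaleA a a' t : oscale a (oscale a' t) = oscale (a * a') t.
Proof.
elim/tensover_ind: t => [u m|? ? IH1 IH2]; last by rewrite !oscaleDr IH1 IH2.
by rewrite !oscaleE mleftM.
Qed.

Lemma oscale1 : left_id 1 oscale.
Proof.
move=> t; elim/tensover_ind: t => [u m|? ? IH1 IH2]; last by rewrite !oscaleDr IH1 IH2.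
by rewrite oscaleE mleft1.
Qed.

Lemma oscaleDl t : {morph oscale^~ t : a a' / a + a'}.
Proof.
move=> a a'; elim/tensover_ind: t => [u m|? ? IH1 IH2].
  by rewrite !oscaleE mleftDl; apply: pureDl.
by rewrite !oscaleDr IH1 IH2 addrACA.
Qed.

HB.instance Definition _ := GRing.Zmodule_isLmodule.Build A tensover
  oscaleA oscale1 oscaleDr oscaleDl.

End TensorOver.

Definition restrict (S R : pzRingType) (phi : {rmorphism S -> R})
  (M : lmodType R) : Type := M.

Section Restriction.
Variables (S R : pzRingType) (phi : {rmorphism S -> R}) (M : lmodType R).

HB.instance Definition _ := GRing.Zmodule.copy (restrict phi M) M.

Definition rscale (s : S) (m : restrict phi M) : restrict phi M :=
  phi s *: (m : M).

Lemma rscaleA s s' m : rscale s (rscale s' m) = rscale (s * s') m.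
Proof. by rewrite /rscale scalerA rmorphM. Qed.
Lemma rscale1 : left_id 1 rscale.
Proof. by move=> m; rewrite /rscale rmorph1 scale1r. Qed.
Lemma rscaleDr : right_distributive rscale +%R.
Proof. by move=> s m m'; apply: scalerDr. Qed.
Lemma rscaleDl m : {morph rscale^~ m : s s' / s + s'}.
Proof. by move=> s s'; rewrite /rscale rmorphD; apply: scalerDl. Qed.

HB.instance Definition _ := GRing.Zmodule_isLmodule.Build S (restrict phi M)
  rscaleA rscale1 rscaleDr rscaleDl.

End Restriction.

Definition fin_gen (R : pzRingType) (M : lmodType R) : Prop :=
  exists (n : nat) (e : 'I_n -> M),
    forall m : M, exists c : 'I_n -> R, m = \sum_i c i *: e i.

Definition projective (R : pzRingType) (P : lmodType R) : Prop :=
  forall (N N' : lmodType R) (g : {linear N -> N'}) (f : {linear P -> N'}),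
    (forall y, exists x, g x = y) ->
    exists h : {linear P -> N}, forall p, g (h p) = f p.

Definition fg_projective (R : pzRingType) (P : lmodType R) : Prop :=
  fin_gen P /\ projective P.

(* ... -> P 2 -> P 1 -> P 0 -> M -> 0 *)
Record resolution (R : pzRingType) (M : lmodType R) := Resolution {
  res_obj : nat -> lmodType R;
  res_d : forall n, {linear res_obj n.+1 -> res_obj n};
  res_aug : {linear res_obj 0 -> M};
  res_proj : forall n, fg_projective (res_obj n);
  res_aug_surj : forall m, exists p, res_aug p = m;
  res_exact0 : forall p, res_aug p = 0 <-> exists q, res_d 0 q = p;
  res_exact : forall n p, res_d n p = 0 <-> exists q, res_d n.+1 q = p }.

(* Ext^(n+1)_R(M, N) = 0: every (n+1)-cocycle of Hom_R(P, N) is a coboundary,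
   for every projective resolution P of M. *)
Definition Ext_succ_vanishes (R : pzRingType) (n : nat) (M N : lmodType R) : Prop :=
  forall (P : resolution M) (f : {linear res_obj P n.+1 -> N}),
    (forall p, f (res_d P n.+1 p) = 0) ->
    exists g : {linear res_obj P n -> N}, forall p, f p = g (res_d P n p).

Definition finite_gldim (R : pzRingType) : Prop :=
  exists d : nat, forall M : lmodType R, fin_gen M ->
    exists P : resolution M, forall i, (d < i)%N -> forall x : res_obj P i, x = 0.

(* The subcategory ^perp R. *)
Definition semi_Gorenstein_projective (R : pzRingType) (M : lmodType R) : Prop :=
  fin_gen M /\ forall n : nat, Ext_succ_vanishes n M R^o.

(* In the conditions on complexes every integer is written i + 1. *)
Definition Gorenstein_projective (R : pzRingType) (G : lmodType R) : Prop :=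
  exists (P : int -> lmodType R) (d : forall i : int, {linear P i -> P (i + 1)}),
    [/\ forall i, fg_projective (P i),
        forall i (p : P (i + 1)), d (i + 1) p = 0 <-> exists q : P i, d i q = p,
        forall Q : lmodType R, fg_projective Q ->
          forall i (f : {linear P (i + 1) -> Q}),
            (forall p : P i, f (d i p) = 0) <->
            exists g : {linear P (i + 1 + 1) -> Q}, forall p, f p = g (d (i + 1) p) &
        exists j : {linear G -> P 0},
          injective j /\ forall p, d 0 p = 0 <-> exists x, j x = p].

Definition left_weakly_Gorenstein (R : pzRingType) : Prop :=
  forall M : lmodType R, semi_Gorenstein_projective M -> Gorenstein_projective M.

Section Semisimple.
Variables (k : fieldType) (B : falgType k).

Definition left_ideal (I : {vspace B}) : Prop := (fullv * I <= I)%VS.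

Definition minimal_left_ideal (I : {vspace B}) : Prop :=
  [/\ left_ideal I, I != 0%VS &
      forall J : {vspace B}, left_ideal J -> (J <= I)%VS -> J = 0%VS \/ J = I].

Definition semisimple_algebra : Prop :=
  exists (n : nat) (S : 'I_n -> {vspace B}),
    [/\ forall i, minimal_left_ideal (S i),
        (\sum_i S i)%VS = fullv & directv (\sum_i S i)].

End Semisimple.

(* Among the equivalent conditions defining monic representations, the one used
   is projectivity over B, where b acts as 1 (x) b. *)

Section Mon.
Variables (k : fieldType) (A B : falgType k).

Definition monic_rep (M : lmodType (tensalg A B)) : Prop :=
  fin_gen M /\ projective (restrict (@tensr k A B) M).

Definition Mon (L : lmodType A -> Prop) (M : lmodType (tensalg A B)) : Prop :=
  monic_rep M /\
  forall Y : lmodType B^c, fin_gen Y -> L (tensover Y M).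

End Mon.

(* Main.v *)
(* Write Lambda = A (x) B.  A finite-dimensional algebra R is left weakly
   Gorenstein iff every semi-Gorenstein-projective module is torsionless: a left
   add(R)-approximation of such a module is then injective with
   semi-Gorenstein-projective cokernel, and iterating this step (together with
   syzygies) produces a complete resolution.

   For Y a right B-module with dual X, A-linear maps Y (x)_B M -> A are the same as
   Lambda-linear maps M -> A (x) X.  Since gldim B is finite, every A (x) X has a
   finite resolution by Lambda-projectives, so Ext_Lambda^i(M, A (x) X) = 0 for
   i >= 1 as soon as M is semi-Gorenstein-projective over Lambda.

   (1) If A is left weakly Gorenstein and M is semi-Gorenstein-projective, then M is
   so over A (take Y = B), hence torsionless over A; the resulting maps
   M -> A (x) D(B) lift along A (x) B^s -> A (x) D(B) because Ext^1 vanishes, so M is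
   torsionless over Lambda.  Conversely N (x) B is semi-Gorenstein-projective when N
   is, and a Lambda-map N (x) B -> Lambda not killing n (x) 1 yields an A-map N -> A
   not killing n.

   (2) By (1), M is an arbitrarily high syzygy of Lambda-modules, hence B-projective.
   So Y (x)_B - preserves a Lambda-resolution of M, and the adjunction above
   identifies the relevant Ext groups; Y = D(B), X = B gives the other inclusion.

   (3) If B is not semisimple, there is a nonsplit injection i : P1 -> P0 of
   projective B-modules.  With phi : N (x) P1 -> Lambda^r a left approximation, the
   cokernel of (1 (x) i, phi) is semi-Gorenstein-projective, hence B-projective by
   assumption; if all A-maps N -> A killed some n <> 0, then phi would vanish on
   n (x) P1 and a B-splitting would restrict to a retraction of i. *)

From HB Require Import structures.
Require Import Defs.
From mathcomp Require Import all_boot all_order all_algebra all_field.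
From mathcomp Require Import boolp.

Set Implicit Arguments.
Unset Strict Implicit.
Unset Printing Implicit Defensive.

Import GRing.Theory.

Local Open Scope ring_scope.
Local Open Scope quotient_scope.

(** * Modules *)

Definition mk_linear (R : pzRingType) (U V : lmodType R) (f : U -> V)
  (fL : linear f) : {linear U -> V} :=
  HB.pack f (GRing.isLinear.Build R U V *:%R f fL).

Section Kernel.
Variables (R : pzRingType) (U V : lmodType R) (f : {linear U -> V}).

Definition ker_pred : {pred U} := fun x => f x == 0.

Lemma ker_pred_closed : submod_closed ker_pred.
Proof.
split=> [|c x y]; rewrite !unfold_in ?linear0 //.
by move=> /eqP fx /eqP fy; rewrite linearP fx fy scaler0 addr0.
Qed.

HB.instance Definition _ := GRing.isSubmodClosed.Build R U ker_pred ker_pred_closed.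

Record ker := Ker { ker_val : U; ker_valP : ker_pred ker_val }.
HB.instance Definition _ := [isSub for ker_val].
HB.instance Definition _ := [Choice of ker by <:].
HB.instance Definition _ := [SubChoice_isSubLmodule of ker by <:].

Lemma ker_val_linear : linear (val : ker -> U).
Proof. by []. Qed.

Definition ker_inc : {linear ker -> U} := mk_linear ker_val_linear.

Lemma ker_inc_inj : injective ker_inc.
Proof. exact: val_inj. Qed.

Lemma ker_incP (x : U) : f x = 0 <-> exists z, ker_inc z = x.
Proof.
split=> [/eqP fx|[z <-]]; last exact/eqP/(ker_valP z).
by exists (@Ker x fx).
Qed.

Lemma ker_inc0 z : f (ker_inc z) = 0.
Proof. by apply/ker_incP; exists z. Qed.

Lemma ker_cor (W : lmodType R) (g : {linear W -> U}) :
  (forall w, f (g w) = 0) -> exists h : {linear W -> ker}, forall w, ker_inc (h w) = g w.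
Proof.
move=> fg; have fg' w : ker_pred (g w) by apply/eqP.
have hL : linear (fun w => Ker (fg' w)).
  by move=> c w w'; apply: val_inj; rewrite /= linearP.
by exists (mk_linear hL).
Qed.

End Kernel.

Section Cokernel.
Variables (R : pzRingType) (U V : lmodType R) (f : {linear U -> V}).

Definition coker_rel (x y : V) : bool := `[< exists u, f u = x - y >].

Lemma coker_rel_refl : reflexive coker_rel.
Proof. by move=> x; apply/asboolP; exists 0; rewrite linear0 subrr. Qed.
Lemma coker_rel_sym : symmetric coker_rel.
Proof.
suff h x y : coker_rel x y -> coker_rel y x by move=> x y; apply/idP/idP; apply: h.
by move=> /asboolP[u fu]; apply/asboolP; exists (- u); rewrite linearN fu opprB.
Qed.
Lemma coker_rel_trans : transitive coker_rel.
Proof.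
move=> y x z /asboolP[u fu] /asboolP[v fv]; apply/asboolP.
by exists (u + v); rewrite linearD fu fv addrA subrK.
Qed.

Canonical coker_equiv :=
  EquivRel coker_rel coker_rel_refl coker_rel_sym coker_rel_trans.

Definition coker : Type := {eq_quot coker_equiv}.
HB.instance Definition _ := Choice.on coker.
HB.instance Definition _ := EqQuotient.on coker.

Lemma coker_eqP (x y : V) :
  \pi_coker x = \pi_coker y <-> exists u, f u = x - y.
Proof.
split; first by move=> /eqmodP/asboolP.
by move=> h; apply/eqmodP/asboolP.
Qed.

Lemma coker_repr (x : V) : exists u, f u = repr (\pi_coker x) - x.
Proof. by apply/coker_eqP; rewrite reprK. Qed.

Definition coker_add (a b : coker) : coker := \pi_coker (repr a + repr b).
Definition coker_opp (a : coker) : coker := \pi_coker (- repr a).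
Definition coker_scale (c : R) (a : coker) : coker := \pi_coker (c *: repr a).

Lemma coker_addE x y : coker_add (\pi_coker x) (\pi_coker y) = \pi_coker (x + y).
Proof.
apply/coker_eqP; have [[u fu] [v fv]] := (coker_repr x, coker_repr y).
by exists (u + v); rewrite linearD fu fv addrACA -opprD.
Qed.
Lemma coker_oppE x : coker_opp (\pi_coker x) = \pi_coker (- x).
Proof.
apply/coker_eqP; have [u fu] := coker_repr x.
by exists (- u); rewrite (linearN f) fu opprD.
Qed.
Lemma coker_scaleE c x : coker_scale c (\pi_coker x) = \pi_coker (c *: x).
Proof.
apply/coker_eqP; have [u fu] := coker_repr x.
by exists (c *: u); rewrite linearZ fu /= scalerBr.
Qed.

Lemma coker_ind (P : coker -> Prop) : (forall x, P (\pi_coker x)) -> forall a, P a.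
Proof. by move=> h a; rewrite -[a]reprK. Qed.

Lemma coker_addA : associative coker_add.
Proof.
elim/coker_ind=> x; elim/coker_ind=> y; elim/coker_ind=> z.
by rewrite !coker_addE addrA.
Qed.
Lemma coker_addC : commutative coker_add.
Proof. by elim/coker_ind=> x; elim/coker_ind=> y; rewrite !coker_addE addrC. Qed.
Lemma coker_add0 : left_id (\pi_coker 0) coker_add.
Proof. by elim/coker_ind=> x; rewrite !coker_addE add0r. Qed.
Lemma coker_addN : left_inverse (\pi_coker 0) coker_opp coker_add.
Proof. by elim/coker_ind=> x; rewrite coker_oppE coker_addE addNr. Qed.

HB.instance Definition _ :=
  GRing.isZmodule.Build coker coker_addA coker_addC coker_add0 coker_addN.

Lemma coker_piD x y : \pi_coker x + \pi_coker y = \pi_coker (x + y).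
Proof. exact: coker_addE. Qed.

Lemma coker_scaleA c d a : coker_scale c (coker_scale d a) = coker_scale (c * d) a.
Proof. by elim/coker_ind: a => x; rewrite !coker_scaleE scalerA. Qed.
Lemma coker_scale1 : left_id 1 coker_scale.
Proof. by elim/coker_ind=> x; rewrite coker_scaleE scale1r. Qed.
Lemma coker_scaleDr : right_distributive coker_scale +%R.
Proof.
move=> c; elim/coker_ind=> x; elim/coker_ind=> y.
by rewrite coker_piD !coker_scaleE coker_piD scalerDr.
Qed.
Lemma coker_scaleDl a : {morph coker_scale^~ a : c d / c + d}.
Proof.
by move=> c d; elim/coker_ind: a => x; rewrite !coker_scaleE coker_piD scalerDl.
Qed.

HB.instance Definition _ := GRing.Zmodule_isLmodule.Build R coker
  coker_scaleA coker_scale1 coker_scaleDr coker_scaleDl.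

Lemma coker_proj_linear : linear (\pi_coker : V -> coker).
Proof.
move=> c x y; rewrite -coker_piD; congr (_ + _).
by rewrite -[RHS]/(coker_scale c _) coker_scaleE.
Qed.

Definition coker_proj : {linear V -> coker} := mk_linear coker_proj_linear.

Lemma coker_proj_surj a : exists x, coker_proj x = a.
Proof. by elim/coker_ind: a => x; exists x. Qed.

Lemma coker_projP x : coker_proj x = 0 <-> exists u, f u = x.
Proof.
have -> : 0 = coker_proj 0 by rewrite linear0.
by rewrite -[x in exists u, _ = x]subr0; apply: coker_eqP.
Qed.

End Cokernel.

(** * Factorization of linear maps, dual bases and short exact sequences *)

Section Factorization.
Variables (R : pzRingType).

(** Since [f] is constant on the fibres of [p], composing it with any set-theoretic section of [p]
    already gives a linear map. *)
Lemma factor_surj (U V W : lmodType R) (p : {linear U -> V}) (f : {linear U -> W}) :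
  (forall y, exists x, p x = y) -> (forall x, p x = 0 -> f x = 0) ->
  exists g : {linear V -> W}, forall x, g (p x) = f x.
Proof.
move=> /choice[s sP] pf.
have fs x : f (s (p x)) = f x.
  by apply/eqP; rewrite -subr_eq0 -linearB; apply/eqP/pf; rewrite linearB sP subrr.
have gL : linear (fun y => f (s y)).
  by move=> c y y'; rewrite -{1}(sP y) -{1}(sP y') -linearP fs linearP.
by exists (mk_linear gL).
Qed.

Lemma factor_inj (U V W : lmodType R) (i : {linear U -> V}) (f : {linear W -> V}) :
  injective i -> (forall w, exists u, i u = f w) ->
  exists g : {linear W -> U}, forall w, i (g w) = f w.
Proof.
move=> inj_i /choice[g gP].
have gL : linear g by move=> c w w'; apply: inj_i; rewrite linearP !gP linearP.
by exists (mk_linear gL).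
Qed.

Lemma linear_inj (U V : lmodType R) (f : {linear U -> V}) :
  (forall u, f u = 0 -> u = 0) -> injective f.
Proof.
move=> f0 u v fuv; apply/eqP; rewrite -subr_eq0; apply/eqP/f0.
by rewrite linearB fuv subrr.
Qed.

Lemma fin_gen_fin (M : lmodType R) (I : finType) (e : I -> M) :
  (forall m, exists c : I -> R, m = \sum_i c i *: e i) -> fin_gen M.
Proof.
move=> h; exists #|I|, (e \o enum_val) => m; have [c ->] := h m.
exists (c \o enum_val).
by rewrite (reindex (@enum_val I predT)) //; apply: onW_bij; apply: enum_val_bij.
Qed.

Lemma fin_gen_surj (M N : lmodType R) (f : {linear M -> N}) :
  fin_gen M -> (forall y, exists x, f x = y) -> fin_gen N.
Proof.
move=> [n [e eP]] fs; exists n, (f \o e) => y; have [x <-] := fs y.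
have [c ->] := eP x; exists c; rewrite linear_sum.
by apply: eq_bigr => i _; rewrite linearZ.
Qed.

Definition free n : lmodType R := {ffun 'I_n -> R^o}.

Lemma comb_linear n (M : lmodType R) (e : 'I_n -> M) :
  linear (fun v : free n => \sum_i (v i : R) *: e i).
Proof.
move=> c v w; rewrite scaler_sumr -big_split /=; apply: eq_bigr => i _.
by rewrite !ffunE scalerDl scalerA.
Qed.
Definition comb n (M : lmodType R) (e : 'I_n -> M) := mk_linear (comb_linear e).

Definition unit_vec n (i : 'I_n) : free n := [ffun j => (j == i)%:R].

Lemma free_sum n (v : free n) : v = \sum_i (v i : R) *: unit_vec i.
Proof.
apply/ffunP => j; rewrite sum_ffunE (bigD1 j) //= big1 ?addr0.
  by rewrite !ffunE eqxx /GRing.scale /= mulr1.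
by move=> i ij; rewrite !ffunE eq_sym (negPf ij) scaler0.
Qed.

Lemma coef_linear n (i : 'I_n) : linear (fun v : free n => v i : R^o).
Proof. by move=> c v w; rewrite !ffunE. Qed.
Definition coef n (i : 'I_n) := mk_linear (coef_linear i).

Lemma fam_linear n (M : lmodType R) (f : 'I_n -> {linear M -> R^o}) :
  linear (fun m => [ffun i => f i m] : free n).
Proof. by move=> c v w; apply/ffunP => i; rewrite !ffunE linearP. Qed.
Definition fam n (M : lmodType R) (f : 'I_n -> {linear M -> R^o}) :=
  mk_linear (fam_linear f).

(** By [fg_projectiveP] this is finitely generated projectivity, in a form that quantifies over no
    test modules; such bases can be transported explicitly along restriction, tensor products and
    retracts. *)
Definition dual_basis (M : lmodType R) : Prop :=
  exists n (e : 'I_n -> M) (f : 'I_n -> {linear M -> R^o}),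
    forall m, m = \sum_i (f i m : R) *: e i.

Lemma dual_basis_fin (M : lmodType R) (I : finType) (e : I -> M)
  (f : I -> {linear M -> R^o}) : (forall m, m = \sum_i (f i m : R) *: e i) -> dual_basis M.
Proof.
move=> h; exists #|I|, (e \o enum_val), (fun i => f (enum_val i)) => m.
rewrite [LHS]h.
by rewrite (reindex (@enum_val I predT)) //; apply: onW_bij; apply: enum_val_bij.
Qed.

Lemma dual_basis_fin_gen (M : lmodType R) : dual_basis M -> fin_gen M.
Proof. by case=> n [e [f h]]; exists n, e => m; exists (f^~ m). Qed.

Lemma dual_basis_proj (M : lmodType R) : dual_basis M -> projective M.
Proof.
case=> n [e [f h]] N N' g u gs.
have [x xP] := choice (fun i => gs (u (e i))).
exists (comb x \o fam f) => p /=; rewrite linear_sum [in RHS](h p) linear_sum.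
by apply: eq_bigr => i _; rewrite !linearZ ffunE xP.
Qed.

Lemma fg_projectiveP (M : lmodType R) : fg_projective M <-> dual_basis M.
Proof.
split=> [[[n [e eP]] pM]|h]; last first.
  by split; [apply: dual_basis_fin_gen | apply: dual_basis_proj].
have [|s sP] := pM _ _ (comb e) (idfun : {linear M -> M}).
  by move=> y; have [c ->] := eP y; exists [ffun i => c i];
     apply: eq_bigr => i _; rewrite ffunE.
exists n, e, (fun i => coef i \o s) => m.
by rewrite -[LHS]sP.
Qed.

Lemma dual_basis_retract (M N : lmodType R) (i : {linear M -> N}) (r : {linear N -> M}) :
  (forall m, r (i m) = m) -> dual_basis N -> dual_basis M.
Proof.
move=> ri [n [e [f h]]]; exists n, (r \o e), (fun j => f j \o i) => m.
rewrite -[LHS]ri [in LHS](h (i m)) linear_sum.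
by apply: eq_bigr => j _; rewrite linearZ.
Qed.

Lemma dual_basis_free n : dual_basis (free n).
Proof. by exists n, (@unit_vec n), (@coef n) => v; apply: free_sum. Qed.

Lemma dual_basis_regular : dual_basis R^o.
Proof.
exists 1%N, (fun=> 1), (fun=> idfun) => m.
by rewrite big_ord1 /GRing.scale /= mulr1.
Qed.

Lemma pair_lin_linear (M N W : lmodType R) (f : {linear W -> M}) (g : {linear W -> N}) :
  linear (fun w => (f w, g w)).
Proof. by move=> c x y; rewrite !linearP. Qed.
Definition pair_lin (M N W : lmodType R) (f : {linear W -> M}) (g : {linear W -> N}) :
  {linear W -> (M * N)%type} := mk_linear (@pair_lin_linear M N W f g).

Lemma sum_lin_linear (M N W : lmodType R) (f : {linear M -> W}) (g : {linear N -> W}) :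
  linear (fun x : (M * N)%type => f x.1 + g x.2).
Proof. by move=> c x y /=; rewrite !linearP /= scalerDr addrACA. Qed.
Definition sum_lin (M N W : lmodType R) (f : {linear M -> W}) (g : {linear N -> W}) :
  {linear (M * N)%type -> W} := mk_linear (@sum_lin_linear M N W f g).

Definition proj1_lin (M N : lmodType R) : {linear (M * N)%type -> M} := fst.
Definition proj2_lin (M N : lmodType R) : {linear (M * N)%type -> N} := snd.

(** The pullback of [f] and [g], realized as the kernel of [g - f] on [N * P], maps onto [P] as soon
    as [g] hits the image of [f]; a section of that projection contains the lift. *)
Lemma proj_lift (P N N' : lmodType R) (g : {linear N -> N'}) (f : {linear P -> N'}) :
  projective P -> (forall p, exists x, g x = f p) ->
  exists h : {linear P -> N}, forall p, g (h p) = f p.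
Proof.
move=> pP gf.
pose d := sum_lin g (\- f : {linear P -> N'}).
have [|s sP] := pP _ _ (proj2_lin _ _ \o ker_inc d) idfun.
  move=> p; have [x gx] := gf p.
  have /ker_incP[z zP] : d (x, p) = 0 by rewrite /= gx subrr.
  by exists z; rewrite /= -[val z]/(ker_inc d z) zP.
exists (proj1_lin _ _ \o (ker_inc d \o s)) => p.
have := sP p; have := ker_inc0 (s p); rewrite /=.
by move=> /eqP; rewrite subr_eq0 => /eqP -> ->.
Qed.

Lemma free_cover (M : lmodType R) : fin_gen M ->
  exists n (p : {linear free n -> M}), forall m, exists v, p v = m.
Proof.
move=> [n [e eP]]; exists n, (comb e) => m; have [c ->] := eP m.
by exists [ffun i => c i]; apply: eq_bigr => i _; rewrite ffunE.
Qed.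

Definition short_exact (K P M : lmodType R) (i : {linear K -> P}) (p : {linear P -> M}) :=
  [/\ injective i, forall m, exists x, p x = m &
      forall x, p x = 0 <-> exists z, i z = x].

Lemma short_exact_ker (P M : lmodType R) (p : {linear P -> M}) :
  (forall m, exists x, p x = m) -> short_exact (ker_inc p) p.
Proof. by move=> ps; split=> //; [apply: ker_inc_inj | apply: ker_incP]. Qed.

Lemma short_exact_coker (K P : lmodType R) (i : {linear K -> P}) :
  injective i -> short_exact i (coker_proj i).
Proof. by move=> ii; split=> //; [apply: coker_proj_surj | apply: coker_projP]. Qed.

Lemma short_exact0 (K P M : lmodType R) i p : @short_exact K P M i p -> forall z, p (i z) = 0.
Proof. by case=> _ _ h z; apply/h; exists z. Qed.

Lemma short_exact_split (K P M : lmodType R) i p : @short_exact K P M i p -> projective M ->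
  exists (r : {linear P -> K}) (s : {linear M -> P}),
    [/\ forall z, r (i z) = z, forall m, p (s m) = m & forall x, x = i (r x) + s (p x)].
Proof.
move=> ex; case: (ex) => ii ps ip pM.
have [s sP] := pM _ _ p idfun ps.
have [r rP] : exists r : {linear P -> K}, forall x, i (r x) = x - s (p x).
  apply: (@factor_inj K P P i (idfun \- (s \o p)) ii) => x /=.
  by apply/ip; rewrite linearB sP subrr.
exists r, s; split=> // [z|x]; last by rewrite rP subrK.
by apply: ii; rewrite rP (short_exact0 ex) linear0 subr0.
Qed.

End Factorization.

Arguments free : clear implicits.

(** * Projective resolutions *)

Lemma dependent_choice_nat (T : nat -> Type) (r : forall n, T n -> T n.+1 -> Prop)
  (x0 : T 0) : (forall n x, exists y, r n x y) ->
  exists f : forall n, T n, f 0 = x0 /\ forall n, r n (f n) (f n.+1).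
Proof.
move=> h; pose s n x := projT1 (cid (h n x)).
pose f := fix f n : T n := if n is n'.+1 then s n' (f n') else x0.
by exists f; split=> // n; apply: (projT2 (cid (h n (f n)))).
Qed.

Section Resolutions.
Variable R : pzRingType.

(** The augmentation counts as the differential leaving degree 0, so that the recursive steps below
    read the same in every degree. *)
Definition cycle (M : lmodType R) (P : resolution M) n : res_obj P n -> Prop :=
  if n is n'.+1 return res_obj P n -> Prop
  then fun p => res_d P n' p = 0 else fun p => res_aug P p = 0.

Lemma cycleP (M : lmodType R) (P : resolution M) n (p : res_obj P n) :
  cycle p <-> exists q, res_d P n q = p.
Proof. by case: n p => [|n] p; [apply: res_exact0 | apply: res_exact]. Qed.

Lemma cycle_d (M : lmodType R) (P : resolution M) n (p : res_obj P n.+1) :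
  cycle (res_d P n p).
Proof. by apply/cycleP; exists p. Qed.

Lemma res_dd (M : lmodType R) (P : resolution M) n (p : res_obj P n.+2) :
  res_d P n (res_d P n.+1 p) = 0.
Proof. exact: (cycle_d p). Qed.

Lemma res_aug_d (M : lmodType R) (P : resolution M) (p : res_obj P 1) :
  res_aug P (res_d P 0 p) = 0.
Proof. exact: (cycle_d p). Qed.

Lemma res_projective (M : lmodType R) (P : resolution M) n : projective (res_obj P n).
Proof. by case: (res_proj P n). Qed.

Lemma res_dual_basis (M : lmodType R) (P : resolution M) n : dual_basis (res_obj P n).
Proof. exact/fg_projectiveP/res_proj. Qed.

Lemma chain_map (M M' : lmodType R) (P : resolution M) (Q : resolution M')
  (f : {linear M -> M'}) : exists F : forall n, {linear res_obj P n -> res_obj Q n},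
  (forall p, res_aug Q (F 0 p) = f (res_aug P p)) /\
  (forall n p, res_d Q n (F n.+1 p) = F n (res_d P n p)).
Proof.
(* Preserving cycles is part of the recursive data: it puts the image of [F \o res_d P n] inside
   that of [res_d Q n], where the next component is lifted. *)
pose T n := {F : {linear res_obj P n -> res_obj Q n} | forall p, cycle p -> cycle (F p)}.
have [F0 F0P] := proj_lift (f := f \o res_aug P) (@res_projective _ P 0)
  (fun p => res_aug_surj Q _).
have F0c p : cycle p -> cycle (F0 p) by rewrite /= F0P /= => ->; rewrite linear0.
pose r n (F : T n) (G : T n.+1) :=
  forall p, res_d Q n (sval G p) = sval F (res_d P n p).
have [n [F Fc]|F [F0E FP]] := @dependent_choice_nat T r (exist _ F0 F0c).
  have [G GP] := proj_lift (g := res_d Q n) (f := F \o res_d P n)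
     (@res_projective _ P n.+1) (fun p => (cycleP _).1 (Fc _ (cycle_d p))).
  have Gc (p : res_obj P n.+1) : cycle p -> cycle (G p).
    by rewrite /= GP /= => ->; rewrite linear0.
  by exists (exist _ G Gc).
exists (fun n => sval (F n)); split=> // p.
by rewrite F0E /= F0P.
Qed.

Lemma homotopy (M M' : lmodType R) (P : resolution M) (Q : resolution M')
  (e : forall n, {linear res_obj P n -> res_obj Q n}) :
  (forall p, res_aug Q (e 0 p) = 0) ->
  (forall n p, res_d Q n (e n.+1 p) = e n (res_d P n p)) ->
  exists h : forall n, {linear res_obj P n -> res_obj Q n.+1},
    (forall p, e 0 p = res_d Q 0 (h 0 p)) /\
    (forall n p, e n.+1 p = res_d Q n.+1 (h n.+1 p) + h n (res_d P n p)).
Proof.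
move=> e0 eD.
(* The invariant [d h = e] on cycles makes [e n.+1 - h d] take its values in cycles, so that the
   next component can be lifted. *)
pose T n := {h : {linear res_obj P n -> res_obj Q n.+1} |
  forall p, cycle p -> res_d Q n (h p) = e n p}.
have [h0 h0P] := proj_lift (g := res_d Q 0) (f := e 0)
  (@res_projective _ P 0) (fun p => (@cycleP _ Q 0 _).1 (e0 p)).
pose r n (h : T n) (h' : T n.+1) :=
  forall p, res_d Q n.+1 (sval h' p) = e n.+1 p - sval h (res_d P n p).
have [n [h hP]|h [h0E rh]] := @dependent_choice_nat T r (exist _ h0 (fun p _ => h0P p)).
  have [p|h' h'P] := proj_lift (g := res_d Q n.+1)
    (f := e n.+1 \- (h \o res_d P n)) (@res_projective _ P n.+1).
    apply/(@cycleP _ Q n.+1).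
    by rewrite /= linearB /= eD hP ?subrr //; apply: cycle_d.
  have h'c (p : res_obj P n.+1) : cycle p -> res_d Q n.+1 (h' p) = e n.+1 p.
    by rewrite /= h'P /= => ->; rewrite linear0 subr0.
  by exists (exist _ h' h'c).
exists (fun n => sval (h n)); split=> [p|n p]; first by rewrite h0E h0P.
by rewrite rh subrK.
Qed.

(** The identity, minus [s \o res_aug P] in degree 0, is a chain map inducing zero on [M]; its
    null-homotopy is the contraction. Taken over [k] or over [B], it keeps resolutions exact under
    tensor products. *)
Lemma contraction (M : lmodType R) (P : resolution M) : projective M ->
  exists (s : {linear M -> res_obj P 0}) (h : forall n, {linear res_obj P n -> res_obj P n.+1}),
    [/\ forall m, res_aug P (s m) = m,
        forall p, p = res_d P 0 (h 0 p) + s (res_aug P p) &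
        forall n p, p = res_d P n.+1 (h n.+1 p) + h n (res_d P n p)].
Proof.
move=> pM; have [s sP] := pM _ _ (res_aug P) idfun (@res_aug_surj _ _ P).
pose e n : {linear res_obj P n -> res_obj P n} :=
  if n is n'.+1 return {linear res_obj P n -> res_obj P n} then idfun
  else idfun \- (s \o res_aug P).
have [p|[|n] p|h [h0 hS]] := @homotopy M M P P e.
- by rewrite /= linearB sP subrr.
- by rewrite /= res_aug_d linear0 subr0.
- by [].
exists s, h; split=> // p.
by rewrite -h0 /= subrK.
Qed.

Definition Ext_succ_at (M : lmodType R) (P : resolution M) n (N : lmodType R) : Prop :=
  forall f : {linear res_obj P n.+1 -> N},
    (forall p, f (res_d P n.+1 p) = 0) ->
    exists g : {linear res_obj P n -> N}, forall p, f p = g (res_d P n p).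

(** The round trip [Q -> P -> Q] of comparison maps is homotopic to the identity. Vanishing of Ext
    may therefore be checked on one convenient resolution. *)
Lemma Ext_succ_indep (M N : lmodType R) (P : resolution M) n :
  Ext_succ_at P n N -> Ext_succ_vanishes n M N.
Proof.
move=> EP Q c cd.
have [F [F0 FS]] := chain_map P Q idfun; have [G [G0 GS]] := chain_map Q P idfun.
have [p|m p|h [_ hS]] := @homotopy M M Q Q (fun m => (F m \o G m) \- idfun).
- by rewrite /= linearB F0 /= G0 subrr.
- by rewrite /= linearB FS GS.
have [p|b bP] := EP (c \o F n.+1); first by rewrite /= -FS cd.
(* Applying [c] to [F G - 1 = d h + h d], with [c d = 0], gives [c = c F G - c h d], where
   [c F = b d]. *)
exists ((b \o G n) \- (c \o h n)) => p /=.
have := congr1 c (hS n p); rewrite /= linearB [X in _ = X -> _]linearD cd add0r => <-.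
by rewrite -GS -bP subKr.
Qed.

Definition splice_obj (P0 K : lmodType R) (Q : resolution K) n : lmodType R :=
  if n is n'.+1 then res_obj Q n' else P0.

Lemma splice_fg_projective (P0 K : lmodType R) (Q : resolution K) n :
  dual_basis P0 -> fg_projective (splice_obj P0 Q n).
Proof. by case: n => [|n] h; [apply/fg_projectiveP | apply: res_proj]. Qed.

Definition splice_d (K P0 : lmodType R) (i : {linear K -> P0}) (Q : resolution K) n :
  {linear splice_obj P0 Q n.+1 -> splice_obj P0 Q n} :=
  match n return {linear splice_obj P0 Q n.+1 -> splice_obj P0 Q n} with
  | 0 => i \o res_aug Q | n'.+1 => res_d Q n' end.

(** In positive degrees the differentials are those of [Q] by computation, so dimension shifting
    from Ext^(n+2) of [M] to Ext^(n+1) of [K] is mere conversion. *)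
Definition splice (K P0 M : lmodType R) (i : {linear K -> P0}) (p : {linear P0 -> M})
  (ex : short_exact i p) (hP : dual_basis P0) (Q : resolution K) : resolution M.
Proof.
refine (@Resolution R M (splice_obj P0 Q) (splice_d i Q) p
  (fun n => splice_fg_projective Q n hP) _ _ _).
- by case: ex.
- move=> x; case: ex => _ _ ->; split=> [[z <-]|[q <-]]; last by exists (res_aug Q q).
  by have [q <-] := res_aug_surj Q z; exists q.
- case=> [|n] q; last exact: res_exact.
  rewrite -(@res_exact0 _ _ Q) /=; split=> [|->]; last exact: linear0.
  by case: ex => ii _ _; rewrite -(linear0 i) => /ii.
Defined.

Definition shift_aug (M : lmodType R) (P : resolution M) :
  {linear res_obj P 1 -> ker (res_aug P)} := projT1 (cid (ker_cor (@res_aug_d _ P))).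

Lemma shift_augE (M : lmodType R) (P : resolution M) p :
  ker_inc (res_aug P) (shift_aug P p) = res_d P 0 p.
Proof. exact: (projT2 (cid (ker_cor (@res_aug_d _ P)))). Qed.

Definition shift (M : lmodType R) (P : resolution M) : resolution (ker (res_aug P)).
Proof.
refine (@Resolution R _ (fun n => res_obj P n.+1) (fun n => res_d P n.+1) (shift_aug P)
  (fun n => res_proj P n.+1) _ _ (fun n => @res_exact _ _ P n.+1)).
- move=> z; have /res_exact0[q qz] := ker_inc0 z.
  by exists q; apply: ker_inc_inj; rewrite shift_augE.
- move=> p; rewrite -res_exact -shift_augE; split=> [->|]; first exact: linear0.
  by rewrite -(linear0 (ker_inc (res_aug P))) => /ker_inc_inj.
Defined.

Definition noetherian := forall (M K : lmodType R) (i : {linear K -> M}),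
  fin_gen M -> injective i -> fin_gen K.

Lemma resolution_exists (M : lmodType R) : noetherian -> fin_gen M -> inhabited (resolution M).
Proof.
move=> nR gM; pose T := {M : lmodType R | fin_gen M}.
have cov (X : T) : {n & {p : {linear free R n -> sval X} | forall m, exists v, p v = m}}.
  have [n /cid h] := cid (free_cover (svalP X)).
  by exists n.
pose p X := sval (projT2 (cov X)).
have pP X : forall m, exists v, p X v = m := svalP (projT2 (cov X)).
have gK X : fin_gen (ker (p X)).
  apply: nR (@ker_inc_inj _ _ _ (p X)); apply: dual_basis_fin_gen.
  exact: dual_basis_free.
(* [K n] is the n-th syzygy, bundled with the finite generation that its free cover requires. *)
pose K n := iter n (fun X => exist _ _ (gK X) : T) (exist _ _ gM).
pose P n := free R (projT1 (cov (K n))).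
pose d n : {linear P n.+1 -> P n} := ker_inc (p (K n)) \o p (K n.+1).
constructor; refine (@Resolution R M P d (p (K 0)) _ (pP (K 0)) _ _).
- by move=> n; apply/fg_projectiveP; apply: dual_basis_free.
- move=> x; rewrite ker_incP; split=> [[z <-]|[q <-]]; last by exists (p (K 1) q).
  by have [q <-] := pP (K 1) z; exists q.
- move=> n x; rewrite -[d n x]/(ker_inc (p (K n)) (p (K n.+1) x)).
  transitivity (p (K n.+1) x = 0).
    split=> [|->]; last exact: linear0.
    by rewrite -(linear0 (ker_inc (p (K n)))) => /ker_inc_inj.
  rewrite ker_incP; split=> [[z <-]|[q <-]]; last by exists (p (K n.+2) q).
  by have [q <-] := pP (K n.+2) z; exists q.
Qed.

End Resolutions.

(** * Restriction of scalars *)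

Section RestrictResolution.
Variables (S R : pzRingType) (phi : {rmorphism S -> R}).

Lemma restrict_linear_proof (M N : lmodType R) (f : {linear M -> N}) :
  linear (f : restrict phi M -> restrict phi N).
Proof. by move=> c x y; apply: (linearP f). Qed.
Definition restrict_linear (M N : lmodType R) (f : {linear M -> N}) :
  {linear restrict phi M -> restrict phi N} := mk_linear (restrict_linear_proof f).

Lemma restrictZ (M : lmodType R) (s : S) (m : restrict phi M) :
  s *: m = phi s *: (m : M) :> M.
Proof. by []. Qed.

Lemma dual_basis_restrict (M : lmodType R) : dual_basis (restrict phi R^o) ->
  dual_basis M -> dual_basis (restrict phi M).
Proof.
move=> [p [a [g ag]]] [n [e [f h]]].
apply: (@dual_basis_fin S (restrict phi M) _
  (fun ij : 'I_p * 'I_n => (a ij.1 : R) *: e ij.2)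
  (fun ij => g ij.1 \o restrict_linear (f ij.2))) => m.
rewrite -(pair_bigA _ (fun i j =>
  (g i (f j m) : S) *: ((a i : R) *: e j : restrict phi M))) exchange_big /=.
rewrite [LHS](h m); apply: eq_bigr => j _.
rewrite [f j m in LHS](ag (f j m)) scaler_suml; apply: eq_bigr => i _.
by rewrite [in RHS]restrictZ !scalerA.
Qed.

Lemma fin_gen_restrict (M : lmodType R) : fin_gen (restrict phi R^o) ->
  fin_gen M -> fin_gen (restrict phi M).
Proof.
move=> [p [a ag]] [n [e h]].
apply: (@fin_gen_fin S (restrict phi M) _
  (fun ij : 'I_p * 'I_n => (a ij.1 : R) *: e ij.2)) => m.
have [c ->] := h m; have [b bP] := choice (fun j => ag (c j)).
exists (fun ij => b ij.2 ij.1).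
rewrite -(pair_bigA _ (fun i j =>
  b j i *: ((a i : R) *: e j : restrict phi M))) exchange_big /=.
apply: eq_bigr => j _.
rewrite [c j in LHS](bP j) scaler_suml; apply: eq_bigr => i _.
by rewrite [in RHS]restrictZ !scalerA.
Qed.

Definition restrict_res (hR : dual_basis (restrict phi R^o)) (M : lmodType R)
  (P : resolution M) : resolution (restrict phi M) :=
  @Resolution S (restrict phi M) (fun n => restrict phi (res_obj P n))
    (fun n => restrict_linear (res_d P n)) (restrict_linear (res_aug P))
    (fun n => (fg_projectiveP _).2 (dual_basis_restrict hR (res_dual_basis P n)))
    (@res_aug_surj _ _ P) (@res_exact0 _ _ P) (@res_exact _ _ P).

End RestrictResolution.

(** * Finite-dimensional algebras *)

Section VectorSpaces.
Variable k : fieldType.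

(** Induction on the number of generators: a nontrivial relation expresses one generator through the
    others, and without such a relation the coordinates are unique, hence linear. *)
Lemma dual_basis_field (M : lmodType k) : fin_gen M -> dual_basis M.
Proof.
case=> n; elim: n => [|n IH] [e eP].
  exists 0%N, (fun=> 0), (fun=> \0) => m.
  by have [c ->] := eP m; rewrite !big_ord0.
have [[c [j [cj c0]]]|free_e] := pselect (exists c : 'I_n.+1 -> k,
    exists j, c j != 0 /\ \sum_i c i *: e i = 0).
  apply: IH; exists (e \o lift j) => m; have [d ->] := eP m.
  have ej : e j = - \sum_i ((c j)^-1 * c (lift j i)) *: e (lift j i).
    move: c0; rewrite (bigD1_ord j) //= => /eqP; rewrite addr_eq0 => /eqP.
    move=> /(congr1 ( *:%R (c j)^-1)); rewrite scalerA mulVf // scale1r => ->.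
    rewrite scalerN scaler_sumr; congr (- _).
    by apply: eq_bigr => i _; rewrite scalerA.
  exists (fun i => d (lift j i) - d j * ((c j)^-1 * c (lift j i))).
  rewrite (bigD1_ord j) //= ej addrC scalerN scaler_sumr -sumrB.
  by apply: eq_bigr => i _; rewrite scalerBl scalerA.
have [c cP] := choice eP.
have uniq_c d d' : \sum_i d i *: e i = \sum_i d' i *: e i -> d =1 d'.
  move=> dd j; apply: contrapT => /eqP neq; apply: free_e.
  exists (fun i => d i - d' i), j; rewrite subr_eq0; split=> //.
  by under eq_bigr do rewrite scalerBl; rewrite sumrB dd subrr.
have cL i : linear (fun m => c m i : k^o).
  move=> a x y; apply: (uniq_c (c _) (fun i => a * c x i + c y i)).
  rewrite -cP [in LHS](cP x) [in LHS](cP y) scaler_sumr -big_split.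
  by apply: eq_bigr => j _; rewrite scalerDl scalerA.
by exists n.+1, e, (fun i => mk_linear (cL i)).
Qed.

Lemma sub_span (V : lmodType k) (P : V -> Prop) : fin_gen V ->
  P 0 -> (forall c x y, P x -> P y -> P (c *: x + y)) ->
  exists r (v : 'I_r -> V), (forall i, P (v i)) /\
    forall x, P x -> exists c : 'I_r -> k, x = \sum_i c i *: v i.
Proof.
move=> /dual_basis_field[n [e [f ef]]] P0 PD.
move: P P0 PD.
(* Induction on [j], where coordinates from index [j] on vanish on [P]; at each stage a vector whose
   last remaining coordinate is nonzero, if there is one, is split off. *)
suff h j : (j <= n)%N -> forall P : V -> Prop, P 0 ->
    (forall c x y, P x -> P y -> P (c *: x + y)) ->
    (forall x (i : 'I_n), P x -> (j <= i)%N -> f i x = 0) ->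
    exists r (v : 'I_r -> V), (forall i, P (v i)) /\
      forall x, P x -> exists c : 'I_r -> k, x = \sum_i c i *: v i.
  move=> P P0 PD; apply: (h n) => // x i _.
  by rewrite leqNgt ltn_ord.
elim: j => [_|j IH jn] P P0 PD Pj.
  exists 0%N, (fun=> 0); split=> [[]//|x Px]; exists (fun=> 0).
  by rewrite big_ord0 [x]ef big1 // => i _; rewrite Pj // scale0r.
pose j' := Ordinal jn.
have [[x0 [Px0 nz]]|none] := pselect (exists x, P x /\ f j' x != 0); last first.
  apply: (IH (ltnW jn)) => // x i Px; rewrite leq_eqVlt => /orP[/eqP ji|]; last exact: Pj.
  have -> : i = j' by apply: val_inj.
  by apply: contrapT => /eqP nz; apply: none; exists x.
have [|c x y [Px fx] [Py fy]|x i [Px fx]|r [v [Pv vP]]] :=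
    IH (ltnW jn) (fun x => P x /\ f j' x = 0).
- by rewrite linear0.
- by split; [exact: PD | rewrite linearP fx fy scaler0 addr0].
- rewrite leq_eqVlt => /orP[/eqP ji|]; last exact: Pj.
  by have -> : i = j' by apply: val_inj.
exists r.+1, (fun i => if unlift ord0 i is Some i' then v i' else x0); split=> [i|x Px].
  by case: unliftP => [i' _|_] //; case: (Pv i').
pose a := f j' x / f j' x0.
have [|c cP] := vP (- a *: x0 + x).
  split; first exact: PD.
  by rewrite linearP /= /GRing.scale /= mulNr divfK // addNr.
exists (fun i => if unlift ord0 i is Some i' then c i' else a).
rewrite big_ord_recl unlift_none; under eq_bigr do rewrite liftK.
by rewrite -cP scaleNr addrA subrr add0r.
Qed.

Lemma noetherian_field : noetherian k.
Proof.
move=> M K i gM ii.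
have [|c _ _ [x <-] [y <-]|r [v [vK vP]]] := @sub_span M (fun m => exists x, i x = m) gM.
- by exists 0; rewrite linear0.
- by exists (c *: x + y); rewrite linearP.
have [w wv] := choice vK; exists r, w => x; have [|c cP] := vP (i x); first by exists x.
exists c; apply: ii; rewrite linear_sum cP.
by apply: eq_bigr => j _; rewrite linearZ wv.
Qed.

Lemma fg_module_field (M : lmodType k) : fin_gen M -> projective M.
Proof. by move=> /dual_basis_field/dual_basis_proj. Qed.

End VectorSpaces.

Section FiniteAlgebras.
Variables (k : fieldType) (R : pzRingType) (phi : {rmorphism k -> R}).
Hypothesis fR : fin_gen (restrict phi R^o).

(** A finite set spanning the submodule over [k] also generates it over [R]. *)
Lemma noetherian_finite : noetherian R.
Proof.
move=> M K i gM ii.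
have [n [e eP]] := noetherian_field (i := restrict_linear phi i) (fin_gen_restrict fR gM) ii.
by exists n, e => x; have [c cP] := eP x; exists (phi \o c).
Qed.

End FiniteAlgebras.

Definition finite_alg (k : fieldType) (R : lalgType k) : Prop :=
  fin_gen (restrict (GRing.in_alg R) R^o).

Section FiniteDimensionalAlgebra.
Variables (k : fieldType) (R : algType k).
Hypothesis fR : finite_alg R.

(** Evaluation at generators embeds the maps [M -> R] in the finite-dimensional space [V], with
    image a subspace. The scalars of [k] stand on the right, where multiplication by them respects
    the left [R]-action. *)
Lemma Hom_span (M : lmodType R) : fin_gen M ->
  exists r (f : 'I_r -> {linear M -> R^o}), forall g : {linear M -> R^o},
    exists c : 'I_r -> k, forall m, g m = \sum_i (f i m : R) * (c i)%:A.
Proof.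
case=> s [e eP].
pose V : lmodType k := {ffun 'I_s -> restrict (GRing.in_alg R) R^o}.
have fV : fin_gen V.
  have [n [a aP]] := fR.
  apply: (@fin_gen_fin _ V _ (fun ij : 'I_n * 'I_s =>
    [ffun j => if j == ij.2 then a ij.1 else 0])) => v.
  have [c cP] := choice (fun j => aP (v j)).
  exists (fun ij => c ij.2 ij.1).
  rewrite -(pair_bigA _ (fun i j =>
    c j i *: ([ffun j' => if j' == j then a i else 0] : V))) /=.
  apply/ffunP => j; rewrite sum_ffunE [LHS]cP; apply: eq_bigr => i _.
  rewrite sum_ffunE (bigD1 j) //= !ffunE eqxx big1 ?addr0 // => j' jj.
  by rewrite !ffunE eq_sym (negPf jj) scaler0.
pose P (v : V) := exists g : {linear M -> R^o}, forall j, v j = g (e j).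
have [||r [v [vP vS]]] := @sub_span k V P fV.
- by exists \0 => j; rewrite ffunE.
- move=> c x y [g gP] [h hP].
  have qL : linear (fun m => (g m : R) * c%:A + h m : R^o).
    move=> b m m'; rewrite !linearP /= /GRing.scale /=.
    by rewrite mulrDl mulrDr mulrA addrACA.
  exists (mk_linear qL) => j.
  by rewrite !ffunE gP hP /= restrictZ /GRing.scale /= mulr_algl mulr_algr.
have [f fP] := choice vP; exists r, f => g.
have [|c cP] := vS [ffun j => g (e j)]; first by exists g => j; rewrite ffunE.
exists c => m; have [d ->] := eP m.
rewrite linear_sum /=.
under [RHS]eq_bigr do rewrite linear_sum mulr_suml.
rewrite exchange_big; apply: eq_bigr => j _ /=.
have := congr1 (fun v : V => v j) cP; rewrite ffunE sum_ffunE linearZ /= => ->.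
rewrite scaler_sumr; apply: eq_bigr => i _.
by rewrite !ffunE fP linearZ /= restrictZ /GRing.scale /= mulr_algl mulr_algr scalerAr.
Qed.

End FiniteDimensionalAlgebra.

(** * Weakly Gorenstein algebras and torsionless modules *)

Section SemiGorenstein.
Variables (R : pzRingType).
Hypothesis nR : noetherian R.

Definition torsionless (M : lmodType R) : Prop :=
  forall m : M, m != 0 -> exists f : {linear M -> R^o}, f m != 0.

Lemma dual_basis_torsionless (M : lmodType R) : dual_basis M -> torsionless M.
Proof.
move=> [n [e [f ef]]] m nz; apply: contrapT => h; case/eqP: nz.
rewrite [m]ef big1 // => i _; suff -> : f i m = 0 by rewrite scale0r.
by apply: contrapT => /eqP nz; apply: h; exists (f i).
Qed.

Lemma torsionless_inj (M N : lmodType R) (f : {linear M -> N}) :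
  injective f -> torsionless N -> torsionless M.
Proof.
move=> fi tN m nz; have [|g gP] := tN (f m); last by exists (g \o f : {linear M -> R^o}).
by apply/eqP; rewrite -(linear0 f) => /fi m0; rewrite m0 eqxx in nz.
Qed.

Lemma Ext_succ_at_dual_basis (M W : lmodType R) (P : resolution M) n :
  Ext_succ_at P n R^o -> dual_basis W -> Ext_succ_at P n W.
Proof.
move=> EP [s [e [f ef]]] c cd.
have /choice[g gP] j : exists g : {linear res_obj P n -> R^o},
    forall p, (f j \o c) p = g (res_d P n p).
  by apply: EP => p /=; rewrite cd linear0.
exists (comb e \o fam g) => p /=; rewrite [c p in LHS]ef.
by apply: eq_bigr => j _; rewrite ffunE -gP.
Qed.

Variables (K P0 M : lmodType R) (i : {linear K -> P0}) (p : {linear P0 -> M}).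
Hypotheses (ex : short_exact i p) (hP : dual_basis P0).

Lemma sgp_ker : semi_Gorenstein_projective M -> semi_Gorenstein_projective K.
Proof.
move=> [gM EM].
have gK : fin_gen K.
  by apply: nR (dual_basis_fin_gen hP) _; case: ex => ii _ _; apply: ii.
have [Q] := resolution_exists nR gK.
split=> // n; apply: (Ext_succ_indep (P := Q)).
exact: (EM n.+1 (splice ex hP Q)).
Qed.

(** [f \o res_aug Q] is a 1-cocycle on the spliced resolution of [M], and the map that bounds it is
    the extension. *)
Lemma sgp_extend (W : lmodType R) (f : {linear K -> W}) :
  semi_Gorenstein_projective M -> dual_basis W ->
  exists g : {linear P0 -> W}, forall z, g (i z) = f z.
Proof.
move=> sM hW; have [gK _] := sgp_ker sM; have [Q] := resolution_exists nR gK.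
have := Ext_succ_at_dual_basis (sM.2 0 (splice ex hP Q)) hW.
move=> /(_ (f \o res_aug Q))[q|g gP]; first by rewrite /= res_aug_d linear0.
exists g => z; have [q <-] := res_aug_surj Q z.
by rewrite -[LHS]gP.
Qed.

(** A 1-cocycle on the splice factors through [K], so the extension hypothesis bounds it; the higher
    Ext groups of [M] are those of [K]. *)
Lemma sgp_coker : semi_Gorenstein_projective K ->
  (forall f : {linear K -> R^o}, exists g : {linear P0 -> R^o}, forall z, g (i z) = f z) ->
  semi_Gorenstein_projective M.
Proof.
move=> [gK EK] ext; have [_ ps _] := ex.
split; first exact: fin_gen_surj (dual_basis_fin_gen hP) ps.
have [Q] := resolution_exists nR gK.
case=> [|n]; apply: (Ext_succ_indep (P := splice ex hP Q)); last exact: EK.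
move=> c cd.
have [f fP] := factor_surj (@res_aug_surj _ _ Q) (fun x => fun h =>
  let: ex_intro q hq := (@res_exact0 _ _ Q x).1 h in
  etrans (congr1 c (esym hq)) (cd q)).
by have [g gP] := ext f; exists g => q; rewrite /= gP fP.
Qed.

End SemiGorenstein.

Section WeaklyGorenstein.
Variables (k : fieldType) (R : algType k).
Hypothesis fR : finite_alg R.

Let nR : noetherian R := noetherian_finite fR.

Lemma left_approximation (M : lmodType R) : fin_gen M ->
  exists r (u : {linear M -> free R r}), forall g : {linear M -> R^o},
    exists h : {linear free R r -> R^o}, forall m, h (u m) = g m.
Proof.
move=> gM; have [r [f fP]] := Hom_span fR gM.
exists r, (fam f) => g; have [c cP] := fP g.
exists (comb (fun i => (c i)%:A : R^o)) => m.
by rewrite cP; apply: eq_bigr => i _; rewrite ffunE.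
Qed.

Lemma approximation_inj (M N : lmodType R) (u : {linear M -> N}) :
  (forall g : {linear M -> R^o}, exists h : {linear N -> R^o}, forall m, h (u m) = g m) ->
  torsionless M -> injective u.
Proof.
move=> uP tM; apply: linear_inj => m um; apply: contrapT => /eqP /tM[g].
by have [h <-] := uP g; rewrite um linear0 eqxx.
Qed.

(* Chains of linked modules, infinite in both directions, are complete resolutions. *)
Definition linked (M N : lmodType R) : Prop :=
  exists (P : lmodType R) (i : {linear M -> P}) (p : {linear P -> N}),
    dual_basis P /\ short_exact i p.

Lemma linked_right (M : lmodType R) : torsionless M -> semi_Gorenstein_projective M ->
  exists N, semi_Gorenstein_projective N /\ linked M N.
Proof.
move=> tM sM; have [r [u uP]] := left_approximation sM.1.
have ex := short_exact_coker (approximation_inj uP tM).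
exists (coker u); split; last first.
  by exists (free R r), u, (coker_proj u); split=> //; apply: dual_basis_free.
exact: (sgp_coker nR ex (dual_basis_free R r) sM uP).
Qed.

Lemma linked_left (N : lmodType R) : semi_Gorenstein_projective N ->
  exists M, semi_Gorenstein_projective M /\ linked M N.
Proof.
move=> sN; have [r [p ps]] := free_cover sN.1; have ex := short_exact_ker ps.
exists (ker p); split; last first.
  by exists (free R r), (ker_inc p), p; split=> //; apply: dual_basis_free.
exact: (sgp_ker nR ex (dual_basis_free R r) sN).
Qed.

Lemma torsionless_Gorenstein_projective (M : lmodType R) :
  Gorenstein_projective M -> torsionless M.
Proof.
move=> [P [d [hP _ _ [j [ji _]]]]]; apply: torsionless_inj ji _.
exact/dual_basis_torsionless/fg_projectiveP.
Qed.

Lemma left_weakly_GorensteinP : left_weakly_Gorenstein R <->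
  forall M : lmodType R, semi_Gorenstein_projective M -> torsionless M.
Proof.
split=> [wR M /wR|tR M sM]; first exact: torsionless_Gorenstein_projective.
pose T := {N : lmodType R | semi_Gorenstein_projective N}.
have /choice[next nextP] (X : T) : exists Y : T, linked (sval X) (sval Y).
  have [N [sN l]] := linked_right (tR _ (svalP X)) (svalP X).
  by exists (exist _ N sN).
have /choice[prev prevP] (Y : T) : exists X : T, linked (sval X) (sval Y).
  by have [N [sN l]] := linked_left (svalP Y); exists (exist _ N sN).
pose X0 : T := exist _ M sM.
(* [M] sits at 0, and [Negz n] is [-(n + 1)], hence [n.+1] steps to the left. *)
pose C (z : int) : T :=
  match z with Posz n => iter n next X0 | Negz n => iter n.+1 prev X0 end.
have linkC z : linked (sval (C z)) (sval (C (z + 1))).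
  case: z => [n|[|n]].
  - by have -> : Posz n + 1 = Posz n.+1 by rewrite -addn1 PoszD.
  - exact: prevP.
  - have -> : Negz n.+1 + 1 = Negz n.
      by rewrite !NegzE -[n.+2]addn1 PoszD opprD addrNK.
    exact: prevP.
have lk z := cid (linkC z); pose P z := projT1 (lk z).
have lk' z := cid (projT2 (lk z)); pose j z : {linear sval (C z) -> P z} := projT1 (lk' z).
have lk'' z := cid (projT2 (lk' z)).
pose p z : {linear P z -> sval (C (z + 1))} := projT1 (lk'' z).
have hP z : dual_basis (P z) by case: (projT2 (lk'' z)).
have ex z : short_exact (j z) (p z) by case: (projT2 (lk'' z)).
have d0 z x : j z x = 0 <-> x = 0.
  split=> [|->]; last exact: linear0.
  by case: (ex z) => ji _ _; rewrite -(linear0 (j z)) => /ji.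
have pe z x : p z x = 0 <-> exists y, j z y = x by case: (ex z).
have ps z y : exists x, p z x = y by case: (ex z).
(* The differential passes through the linked module: [P z -> C (z + 1) -> P (z + 1)]. *)
exists P, (fun z => j (z + 1) \o p z); split=> [z|z x|Q hQ z f|].
- exact/fg_projectiveP.
- rewrite /= d0 pe; split=> [[y <-]|[q <-]]; last by exists (p z q).
  by have [q <-] := ps z y; exists q.
(* A map killed by the incoming differential factors through [C (z + 1 + 1)], and then extends along
   [j] because the next module of the chain is semi-Gorenstein-projective. *)
- split=> [fd|[g gP] x]; last first.
    have -> := gP (j (z + 1) (p z x)).
    by rewrite /= (short_exact0 (ex (z + 1))) !linear0.
  have [x /pe[y <-]|f' f'P] := factor_surj (f := f) (ps (z + 1)).
    by have [q <-] := ps z y; apply: fd.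
  have [g gP] := sgp_extend nR (ex (z + 1 + 1)) (hP _) f' (svalP (C _))
    ((fg_projectiveP _).1 hQ).
  by exists g => x; rewrite /= gP f'P.
- exists (j 0); split=> [|x]; first by case: (ex 0).
  by rewrite /= d0 pe.
Qed.

End WeaklyGorenstein.

(** * The Lambda-module N (x) X *)

Section TensorProductModule.
Variables (k : fieldType) (A B : falgType k).
Local Notation L := (tensalg A B).

Definition tensl (a : A) : L := tpure a 1.

Lemma tensl_is_zmod_morphism : zmod_morphism tensl.
Proof.
move=> a a'; rewrite /tensl; apply: (addIr (tpure a' 1)).
by rewrite subrK -tpureDl subrK.
Qed.
Lemma tensl_is_monoid_morphism : monoid_morphism tensl.
Proof. by split=> // a a'; rewrite tpureM mulr1. Qed.
HB.instance Definition _ := GRing.isZmodMorphism.Build A L tensl tensl_is_zmod_morphism.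
HB.instance Definition _ := GRing.isMonoidMorphism.Build A L tensl tensl_is_monoid_morphism.

Lemma tenslr (a : A) (b : B) : tensl a * tensr A b = tpure a b.
Proof. by rewrite tpureM mulr1 mul1r. Qed.
Lemma tensrl (a : A) (b : B) : tensr A b * tensl a = tpure a b.
Proof. by rewrite tpureM mulr1 mul1r. Qed.
Lemma tensl_alg (c : k) : tensl c%:A = tensr A c%:A.
Proof. by rewrite /tensl tpureZ. Qed.

Section Module.
Variables (N : lmodType A) (X : lmodType B).

Definition ntens : Type :=
  tens (fun (c : k) (n : N) => c%:A *: n) (fun (c : k) (x : X) => c%:A *: x).
HB.instance Definition _ := GRing.Zmodule.on ntens.

Definition npure (n : N) (x : X) : ntens := pure _ _ n x.

Lemma npureDl n n' x : npure (n + n') x = npure n x + npure n' x.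
Proof. exact: pureDl. Qed.
Lemma npureDr n x x' : npure n (x + x') = npure n x + npure n x'.
Proof. exact: pureDr. Qed.
Lemma npureZ c n x : npure (c%:A *: n) x = npure n (c%:A *: x).
Proof. exact: (@pureM _ _ _ _ _ c). Qed.

Lemma ntens_ind (P : ntens -> Prop) : (forall n x, P (npure n x)) ->
  (forall s t, P s -> P t -> P (s + t)) -> forall t, P t.
Proof. exact: tens_ind. Qed.

Definition nscale (w : L) (t : ntens) : ntens :=
  tens_lift (fun a b => tens_lift (fun n x => npure (a *: n) (b *: x)) t) w.

Lemma nscale_bal1 a b :
  balanced (fun (c : k) (n : N) => c%:A *: n) (fun (c : k) (x : X) => c%:A *: x)
    (fun n x => npure (a *: n) (b *: x)).
Proof.
split=> *; rewrite ?scalerDr ?npureDl ?npureDr //.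
by rewrite !scalerA !(mulr_algl, mulr_algr) -!(mulr_algl _ a) -!(mulr_algl _ b)
  -!scalerA npureZ.
Qed.

Lemma nscale_bal2 (t : ntens) :
  balanced (fun (c : k) (a : A) => c *: a) (fun (c : k) (b : B) => c *: b)
    (fun a b => tens_lift (fun n x => npure (a *: n) (b *: x)) t : ntens).
Proof.
split; elim/ntens_ind: t => [n x|t t' IHt IHt'] *.
- by rewrite !(tens_liftE _ _ (nscale_bal1 _ _)) scalerDl npureDl.
- by rewrite !(tens_liftD (nscale_bal1 _ _)) IHt IHt' addrACA.
- by rewrite !(tens_liftE _ _ (nscale_bal1 _ _)) scalerDl npureDr.
- by rewrite !(tens_liftD (nscale_bal1 _ _)) IHt IHt' addrACA.
- by rewrite !(tens_liftE _ _ (nscale_bal1 _ _)) -mulr_algl -[in RHS]mulr_algl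
    -!scalerA npureZ.
- by rewrite !(tens_liftD (nscale_bal1 _ _)) IHt IHt'.
Qed.

Lemma nscaleE a b n x : nscale (tpure a b) (npure n x) = npure (a *: n) (b *: x).
Proof.
by rewrite /nscale (tens_liftE _ _ (nscale_bal2 _)) (tens_liftE _ _ (nscale_bal1 _ _)).
Qed.

Lemma nscaleDl t : {morph nscale^~ t : w w' / w + w'}.
Proof. by move=> w w'; rewrite /nscale (tens_liftD (nscale_bal2 _)). Qed.

Lemma nscaleDr : right_distributive nscale +%R.
Proof.
move=> w t t'; elim/tensalg_ind: w => [a b|w w' IH IH'].
  by rewrite /nscale !(tens_liftE _ _ (nscale_bal2 _)) (tens_liftD (nscale_bal1 _ _)).
by rewrite !nscaleDl IH IH' addrACA.
Qed.

Lemma nscaleA w w' t : nscale w (nscale w' t) = nscale (w * w') t.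
Proof.
elim/ntens_ind: t => [n x|? ? IH1 IH2]; last by rewrite !nscaleDr IH1 IH2.
elim/tensalg_ind: w' => [a' b'|? ? IH1 IH2]; last first.
  by rewrite mulrDr !nscaleDl nscaleDr IH1 IH2.
elim/tensalg_ind: w => [a b|? ? IH1 IH2]; last by rewrite mulrDl !nscaleDl IH1 IH2.
by rewrite tpureM !nscaleE !scalerA.
Qed.

Lemma nscale1 : left_id 1 nscale.
Proof.
move=> t; elim/ntens_ind: t => [n x|? ? IH1 IH2]; last by rewrite nscaleDr IH1 IH2.
by rewrite [LHS]nscaleE !scale1r.
Qed.

HB.instance Definition _ := GRing.Zmodule_isLmodule.Build L ntens
  nscaleA nscale1 nscaleDr nscaleDl.

Lemma scale_npure a b n x : tpure a b *: npure n x = npure (a *: n) (b *: x).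
Proof. exact: nscaleE. Qed.
Lemma tensl_npure a n x : tensl a *: npure n x = npure (a *: n) x.
Proof. by rewrite scale_npure scale1r. Qed.
Lemma tensr_npure b n x : tensr A b *: npure n x = npure n (b *: x).
Proof. by rewrite scale_npure scale1r. Qed.

Lemma npure0 n : npure n 0 = 0.
Proof. by apply: (addrI (npure n 0)); rewrite -npureDr !addr0. Qed.
Lemma npure0l x : npure 0 x = 0.
Proof. by apply: (addrI (npure 0 x)); rewrite -npureDl !addr0. Qed.
Lemma npure_suml (I : finType) (n : I -> N) x :
  npure (\sum_i n i) x = \sum_i npure (n i) x.
Proof.
by apply: (big_morph (fun n => npure n x) _ (npure0l x)) => u v; rewrite npureDl.
Qed.
Lemma npure_sumr (I : finType) n (x : I -> X) :
  npure n (\sum_i x i) = \sum_i npure n (x i).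
Proof.
by apply: (big_morph (npure n) _ (npure0 n)) => u v; rewrite npureDr.
Qed.

Lemma ntens_ext (Z : zmodType) (g h : ntens -> Z) :
  {morph g : x y / x + y} -> {morph h : x y / x + y} ->
  (forall n x, g (npure n x) = h (npure n x)) -> g =1 h.
Proof. exact: tens_ext. Qed.

Lemma nlift_add (Z : zmodType) (f : N -> X -> Z) :
  (forall n n' x, f (n + n') x = f n x + f n' x) ->
  (forall n x x', f n (x + x') = f n x + f n x') ->
  (forall c n x, f (c%:A *: n) x = f n (c%:A *: x)) ->
  exists h : ntens -> Z, {morph h : s t / s + t} /\ forall n x, h (npure n x) = f n x.
Proof.
move=> fDl fDr fZ; exists (tens_lift f).
have hf : balanced (fun (c : k) (n : N) => c%:A *: n)
  (fun (c : k) (x : X) => c%:A *: x) f by [].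
by split=> [|n x]; [apply: tens_liftD | apply: tens_liftE].
Qed.

Lemma ntens_linear (Z : lmodType L) (h : ntens -> Z) : {morph h : s t / s + t} ->
  (forall a b n x, h (npure (a *: n) (b *: x)) = tpure a b *: h (npure n x)) -> linear h.
Proof.
move=> hD hZ w s t; rewrite hD; congr (_ + _).
elim/ntens_ind: s => [n x|s s' IH IH']; last by rewrite scalerDr !hD scalerDr IH IH'.
elim/tensalg_ind: w => [a b|w w' IH IH']; first by rewrite scale_npure hZ.
by rewrite !scalerDl hD IH IH'.
Qed.

(** Linearity over [A] and [B] in the two variables contains the balance over [k], because [tensl]
    and [tensr] agree on scalars. *)
Lemma nlift (Z : lmodType L) (f : N -> X -> Z) :
  (forall n n' x, f (n + n') x = f n x + f n' x) ->
  (forall n x x', f n (x + x') = f n x + f n x') ->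
  (forall a n x, f (a *: n) x = tensl a *: f n x) ->
  (forall b n x, f n (b *: x) = tensr A b *: f n x) ->
  exists h : {linear ntens -> Z}, forall n x, h (npure n x) = f n x.
Proof.
move=> fDl fDr fA fB; have [c n x|h [hD hE]] := nlift_add fDl fDr.
  by rewrite fA fB tensl_alg.
have hL : linear h.
  by apply: ntens_linear => // a b n x; rewrite !hE fA fB scalerA tenslr.
by exists (mk_linear hL).
Qed.

End Module.

Section Functoriality.
Variables (N N' : lmodType A) (X X' : lmodType B).

(** Splittings and homotopies of the underlying vector spaces are only [k]-linear; they still act
    additively on the tensor product. *)
Lemma nmap_k (f : {linear restrict (GRing.in_alg A) N -> restrict (GRing.in_alg A) N'})
  (g : {linear restrict (GRing.in_alg B) X -> restrict (GRing.in_alg B) X'}) :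
  exists h : ntens N X -> ntens N' X', {morph h : s t / s + t} /\
    forall n x, h (npure n x) = npure (f n) (g x).
Proof.
apply: nlift_add => [n n' x|n x x'|c n x]; rewrite ?linearD ?npureDl ?npureDr //.
have -> : f (c%:A *: n) = c%:A *: (f n : N') := linearZ_LR f c n.
have -> : g (c%:A *: x) = c%:A *: (g x : X') := linearZ_LR g c x.
by rewrite npureZ.
Qed.

Lemma nmap_proof (f : {linear N -> N'}) (g : {linear X -> X'}) :
  exists h : {linear ntens N X -> ntens N' X'},
    forall n x, h (npure n x) = npure (f n) (g x).
Proof.
apply: nlift => [n n' x|n x x'|a n x|b n x]; rewrite ?linearD ?npureDl ?npureDr //.
- by rewrite linearZ_LR tensl_npure.
- by rewrite linearZ_LR tensr_npure.
Qed.

Definition nmap f g : {linear ntens N X -> ntens N' X'} := projT1 (cid (nmap_proof f g)).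
Lemma nmapE f g n x : nmap f g (npure n x) = npure (f n) (g x).
Proof. exact: (projT2 (cid (nmap_proof f g))). Qed.

End Functoriality.

Lemma finite_falg (C : falgType k) : finite_alg C.
Proof.
exists (\dim {:C}), (fun i => (vbasis {:C})`_i) => m.
exists (fun i => coord (vbasis {:C}) i m).
rewrite [LHS](coord_vbasis (memvf m)); apply: eq_bigr => i _.
by rewrite restrictZ /GRing.scale /= mulr_algl.
Qed.

Lemma dual_basis_falg (C : falgType k) (N : lmodType C) : fin_gen N ->
  dual_basis (restrict (GRing.in_alg C) N).
Proof. by move=> gN; apply/dual_basis_field/fin_gen_restrict/gN/finite_falg. Qed.

Lemma dual_basis_ntens (N : lmodType A) (X : lmodType B) :
  dual_basis N -> dual_basis X -> dual_basis (ntens N X).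
Proof.
move=> [n [e [f ef]]] [m [y [g yg]]].
have /choice[h hE] (ij : 'I_n * 'I_m) : exists h : {linear ntens N X -> L^o},
    forall u x, h (npure u x) = tpure (f ij.1 u) (g ij.2 x).
  apply: nlift => [u u' x|u x x'|a u x|b u x]; rewrite ?linearD ?tpureDl ?tpureDr //.
  - by rewrite linearZ_LR /GRing.scale /= tpureM mul1r.
  - by rewrite linearZ_LR /GRing.scale /= tpureM mul1r.
apply: (@dual_basis_fin _ _ _ (fun ij : 'I_n * 'I_m => npure (e ij.1) (y ij.2)) h).
apply: ntens_ext => [//|s t|u x].
  by under eq_bigr do rewrite linearD scalerDl; rewrite big_split.
under eq_bigr do rewrite hE scale_npure.
rewrite -(pair_bigA _ (fun i j => npure ((f i u : A) *: e i) ((g j x : B) *: y j))) /=.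
rewrite [u in LHS]ef npure_suml; apply: eq_bigr => i _.
by rewrite [x in LHS]yg npure_sumr.
Qed.

(** A [k]-dual basis [y, g] of [B] yields the generators [1 (x) y j] of Lambda over [A], with
    coordinates [a (x) b |-> g j b *: a]. *)
Lemma dual_basis_tensl : dual_basis (restrict tensl L^o).
Proof.
have [m [y [g yg]]] := dual_basis_falg (dual_basis_fin_gen (dual_basis_regular B)).
have gZ j c x : g j (c *: (x : B)) = c * g j x.
  by rewrite -mulr_algl; apply: (linearZ_LR (g j) c x).
have /choice[h hP] j : exists h : {linear restrict tensl L^o -> A^o},
    forall a b, h (tpure a b) = g j b *: (a : A).
  have hf : balanced (fun (c : k) (a : A) => c *: a) (fun (c : k) (b : B) => c *: b)
      (fun a b => g j b *: (a : A)).
    split=> [a a' b|a b b'|c a b]; rewrite ?scalerDr ?linearD ?scalerDl //.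
    by rewrite gZ scalerA mulrC.
  have hL : linear (tens_lift (fun a b => g j b *: (a : A)) : restrict tensl L^o -> A^o).
    move=> c s t; rewrite (tens_liftD hf); congr (_ + _).
    elim/tensalg_ind: s => [a b|s s' IH IH'].
      rewrite restrictZ /GRing.scale /= tpureM mul1r !(tens_liftE _ _ hf).
      by rewrite scalerAr.
    by rewrite scalerDr !(tens_liftD hf) IH IH' scalerDr.
  by exists (mk_linear hL) => a b; apply: (tens_liftE _ _ hf).
exists m, (fun j => tensr A (y j)), h.
apply: (@tens_ext _ _ _ _ _ (restrict tensl L^o)) => [//|s t|a b].
  by under eq_bigr do rewrite linearD scalerDl; rewrite big_split.
transitivity (tpure a (\sum_j g j b *: (y j : B))).
  congr tpure; rewrite [LHS]yg; apply: eq_bigr => j _.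
  by rewrite restrictZ /GRing.scale /= mulr_algl.
have tp0 : tpure a (0 : B) = 0 by apply: (addrI (tpure a 0)); rewrite -tpureDr !addr0.
rewrite (big_morph (tpure a) (fun b b' => tpureDr a b b') tp0).
apply: eq_bigr => j _.
by rewrite [h j _]hP restrictZ /GRing.scale /= tpureM mul1r mulr1 -tpureZ.
Qed.

End TensorProductModule.

Section Lambda.
Variables (k : fieldType) (A B : falgType k).
Local Notation L := (tensalg A B).

Lemma dual_basis_tensr : dual_basis (restrict (@tensr k A B) L^o).
Proof.
have [m [y [g yg]]] := dual_basis_falg (dual_basis_fin_gen (dual_basis_regular A)).
have gZ j c x : g j (c *: (x : A)) = c * g j x.
  by rewrite -mulr_algl; apply: (linearZ_LR (g j) c x).
have /choice[h hP] j : exists h : {linear restrict (@tensr k A B) L^o -> B^o},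
    forall a b, h (tpure a b) = g j a *: (b : B).
  have hf : balanced (fun (c : k) (a : A) => c *: a) (fun (c : k) (b : B) => c *: b)
      (fun a b => g j a *: (b : B)).
    split=> [a a' b|a b b'|c a b]; rewrite ?scalerDr ?linearD ?scalerDl //.
    by rewrite gZ scalerA mulrC.
  have hL : linear (tens_lift (fun a b => g j a *: (b : B)) :
      restrict (@tensr k A B) L^o -> B^o).
    move=> c s t; rewrite (tens_liftD hf); congr (_ + _).
    elim/tensalg_ind: s => [a b|s s' IH IH'].
      rewrite restrictZ /GRing.scale /= tpureM mul1r !(tens_liftE _ _ hf).
      by rewrite scalerAr.
    by rewrite scalerDr !(tens_liftD hf) IH IH' scalerDr.
  by exists (mk_linear hL) => a b; apply: (tens_liftE _ _ hf).
exists m, (fun j => tensl B (y j)), h.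
apply: (@tens_ext _ _ _ _ _ (restrict (@tensr k A B) L^o)) => [//|s t|a b].
  by under eq_bigr do rewrite linearD scalerDl; rewrite big_split.
transitivity (tpure (\sum_j g j a *: (y j : A)) b).
  congr tpure; rewrite [LHS]yg; apply: eq_bigr => j _.
  by rewrite restrictZ /GRing.scale /= mulr_algl.
have tp0 : tpure (0 : A) b = 0 by apply: (addrI (tpure 0 b)); rewrite -tpureDl !addr0.
have tpD : {morph (fun a : A => tpure a b) : a a' / a + a'} by move=> a1 a2; apply: tpureDl.
rewrite [LHS](big_morph (fun a : A => tpure a b) tpD tp0).
apply: eq_bigr => j _.
by rewrite [h j _]hP restrictZ /GRing.scale /= tpureM mul1r mulr1 tpureZ.
Qed.

Lemma finite_tensalg : finite_alg L.
Proof.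
have [m [y yP]] := dual_basis_fin_gen (dual_basis_tensl A B).
have [n [e eP]] := finite_falg A.
apply: (@fin_gen_fin k (restrict (GRing.in_alg L) L^o) _
  (fun ij : 'I_m * 'I_n => tensl B (e ij.2) * (y ij.1 : L))) => w.
have [c ->] := yP w; have [d dP] := choice (fun j => eP (c j)).
exists (fun ij => d ij.1 ij.2).
rewrite -(pair_bigA _ (fun i j => d i j *: (tensl B (e j) * (y i : L) :
  restrict (GRing.in_alg L) L^o))) /=.
apply: eq_bigr => i _; rewrite restrictZ [c i in LHS]dP rmorph_sum scaler_suml.
apply: eq_bigr => j _; rewrite !restrictZ /GRing.scale /= rmorphM mulrA.
by congr (_ * _ * _); apply: esym; apply: mulr1.
Qed.

(** The given sequence splits over [k]; by [nmap_k] its retraction and section survive the tensor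
    product and force exactness. *)
Lemma short_exact_ntens (N : lmodType A) (K P X : lmodType B)
  (i : {linear K -> P}) (p : {linear P -> X}) : fin_gen X -> short_exact i p ->
  short_exact (nmap (idfun : {linear N -> N}) i) (nmap idfun p).
Proof.
move=> gX ex; pose phi := GRing.in_alg B.
have exk : short_exact (restrict_linear phi i) (restrict_linear phi p) := ex.
have gXk : fin_gen (restrict phi X) := fin_gen_restrict (finite_falg B) gX.
have [r [s [ri ps irsp]]] := short_exact_split exk (fg_module_field gXk).
have [r' [r'D r'E]] := nmap_k (N := N) idfun r.
have [s' [s'D s'E]] := nmap_k (N := N) idfun s.
have r'i t : r' (nmap idfun i t) = t.
  elim/ntens_ind: t => [n x|t t' IH IH']; last by rewrite linearD r'D IH IH'.
  by rewrite nmapE r'E [r _]ri.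
have ps' t : nmap idfun p (s' t) = t.
  elim/ntens_ind: t => [n x|t t' IH IH']; last by rewrite s'D linearD IH IH'.
  by rewrite s'E nmapE [p _]ps.
have e t : t = nmap idfun i (r' t) + s' (nmap idfun p t).
  elim/ntens_ind: t => [n x|t t' IH IH'].
    by rewrite nmapE r'E s'E nmapE -npureDr; congr npure; apply: irsp.
  by rewrite linearD r'D s'D linearD addrACA -IH -IH'.
split.
- by move=> t t' /(congr1 r'); rewrite !r'i.
- by move=> t; exists (s' t).
- move=> t; split=> [pt|[z <-]].
    have s'0 : s' 0 = 0 by apply: (addrI (s' 0)); rewrite -s'D !addr0.
    by exists (r' t); rewrite [RHS]e pt s'0 addr0.
  elim/ntens_ind: z => [n x|z z' IH IH']; last by rewrite !linearD IH IH' addr0.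
  by rewrite !nmapE (short_exact0 ex) npure0.
Qed.

Section TensorResolution.
Variables (N : lmodType A) (X : lmodType B) (P : resolution N).
Hypotheses (gN : fin_gen N) (hX : dual_basis X).

Let phi := GRing.in_alg A.
Let hA : dual_basis (restrict phi A^o) :=
  dual_basis_falg (dual_basis_fin_gen (dual_basis_regular A)).
Let gNk : projective (restrict phi N) := fg_module_field (fin_gen_restrict (finite_falg A) gN).

Lemma ntens_res_surj t : exists s, nmap (res_aug P) (idfun : {linear X -> X}) s = t.
Proof.
elim/ntens_ind: t => [n x|t t' [s <-] [s' <-]]; last by exists (s + s'); rewrite linearD.
by have [p <-] := res_aug_surj P n; exists (npure p x); rewrite nmapE.
Qed.

(** Over [k] the augmented resolution of [N] is contractible, and the contraction can be tensored
    with [X]. The same argument serves in higher degrees. *)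
Lemma ntens_res_exact0 t :
  nmap (res_aug P) (idfun : {linear X -> X}) t = 0 <->
  exists s, nmap (res_d P 0) idfun s = t.
Proof.
have [s [h [augs h0 _]]] := contraction (restrict_res hA P) gNk.
have [s' [s'D s'E]] := nmap_k (X := X) s idfun.
have [h' [h'D h'E]] := nmap_k (X := X) (h 0) idfun.
have e u : u = nmap (res_d P 0) idfun (h' u) + s' (nmap (res_aug P) idfun u).
  elim/ntens_ind: u => [n x|u u' IH IH'].
    by rewrite nmapE h'E s'E nmapE -npureDl; congr npure; apply: h0.
  by rewrite linearD h'D s'D linearD addrACA -IH -IH'.
split=> [t0|[u <-]].
  have s'0 : s' 0 = 0 by apply: (addrI (s' 0)); rewrite -s'D !addr0.
  by exists (h' t); rewrite [RHS]e t0 s'0 addr0.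
elim/ntens_ind: u => [n x|z z' IH IH']; last by rewrite !linearD IH IH' addr0.
by rewrite !nmapE res_aug_d npure0l.
Qed.

Lemma ntens_res_exact m t :
  nmap (res_d P m) (idfun : {linear X -> X}) t = 0 <->
  exists s, nmap (res_d P m.+1) idfun s = t.
Proof.
have [s [h [_ _ hS]]] := contraction (restrict_res hA P) gNk.
have [s' [s'D s'E]] := nmap_k (X := X) (h m) idfun.
have [h' [h'D h'E]] := nmap_k (X := X) (h m.+1) idfun.
have e u : u = nmap (res_d P m.+1) idfun (h' u) + s' (nmap (res_d P m) idfun u).
  elim/ntens_ind: u => [n x|u u' IH IH'].
    by rewrite nmapE h'E s'E nmapE -npureDl; congr npure; apply: hS.
  by rewrite linearD h'D s'D linearD addrACA -IH -IH'.
split=> [t0|[u <-]].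
  have s'0 : s' 0 = 0 by apply: (addrI (s' 0)); rewrite -s'D !addr0.
  by exists (h' t); rewrite [RHS]e t0 s'0 addr0.
elim/ntens_ind: u => [n x|z z' IH IH']; last by rewrite !linearD IH IH' addr0.
by rewrite !nmapE res_dd npure0l.
Qed.

Definition ntens_res : resolution (ntens N X) :=
  @Resolution L (ntens N X) (fun n => ntens (res_obj P n) X)
    (fun n => nmap (res_d P n) idfun) (nmap (res_aug P) idfun)
    (fun n => (fg_projectiveP _).2 (dual_basis_ntens (res_dual_basis P n) hX))
    ntens_res_surj ntens_res_exact0 ntens_res_exact.

End TensorResolution.

Lemma sgp_ntens (N : lmodType A) (X : lmodType B) :
  semi_Gorenstein_projective N -> dual_basis X ->
  semi_Gorenstein_projective (ntens N X).
Proof.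
move=> [gN EN] hX; have [P] := resolution_exists (noetherian_finite (finite_falg A)) gN.
split=> [|n].
  apply: fin_gen_surj (@ntens_res_surj N X P).
  exact: dual_basis_fin_gen (dual_basis_ntens (res_dual_basis P 0) hX).
apply: (Ext_succ_indep (P := ntens_res P gN hX)) => c cd.
have [m [y [g yg]]] := hX.
(* Fixing [y j] turns [c] into an [A]-linear cocycle on [P] with values in Lambda, which is
   projective over [A]; so it is a coboundary. *)
have /choice[q qP] j : exists q : {linear res_obj P n -> restrict (tensl B) L^o},
    forall p, c (npure p (y j)) = q (res_d P n p).
  have cL : linear (fun p => c (npure p (y j)) : restrict (tensl B) L^o).
    by move=> a p p'; rewrite npureDl -tensl_npure linearP.
  apply: (Ext_succ_at_dual_basis (EN n P) (dual_basis_tensl A B) (f := mk_linear cL)).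
  by move=> p /=; have := cd (npure p (y j)); rewrite /= nmapE.
(* The bounding maps [q j] are reassembled through the coordinates [g j] of [X]. *)
have [p p' x|p x x'|a p x|b p x|h hP] := nlift (N := res_obj P n) (X := X) (Z := L^o)
  (f := fun p x => \sum_j tensr A (g j x) * (q j p : L)).
- by rewrite -big_split; apply: eq_bigr => j _; rewrite linearD mulrDr.
- by rewrite -big_split; apply: eq_bigr => j _; rewrite linearD rmorphD mulrDl.
- rewrite scaler_sumr; apply: eq_bigr => j _; rewrite linearZ_LR restrictZ.
  by rewrite /GRing.scale /= !mulrA tenslr tensrl.
- rewrite scaler_sumr; apply: eq_bigr => j _; rewrite linearZ_LR.
  by rewrite /GRing.scale /= rmorphM mulrA.
exists h; apply: ntens_ext => [s t|s t|p x]; rewrite ?linearD //.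
rewrite nmapE hP [x in LHS]yg npure_sumr linear_sum.
by apply: eq_bigr => j _; rewrite -qP -tensr_npure linearZ_LR.
Qed.

End Lambda.

(** * Descent to a tensor factor and coinduced modules *)

Section WeaklyGorensteinTensor.
Variables (k : fieldType) (A B : falgType k).
Local Notation L := (tensalg A B).

(** Contracting the first factor with a [k]-form keeps [B]-linearity. This detects nonzero tensors,
    extracts components in [X], and later produces a retraction over [B]. *)
Lemma ncontract (N : lmodType A) (X : lmodType B)
  (l : {linear restrict (GRing.in_alg A) N -> k^o}) :
  exists h : {linear restrict (@tensr k A B) (ntens N X) -> X},
    forall n x, h (npure n x) = (l n : k)%:A *: x.
Proof.
have [n n' x|n x x'|c n x|h [hD hE]] :=
  nlift_add (N := N) (X := X) (f := fun n x => (l n : k)%:A *: x).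
- by rewrite linearD !scalerDl.
- by rewrite scalerDr.
- have -> : l (c%:A *: n) = c * l n := linearZ_LR l c n.
  by rewrite scalerA mulr_algl scalerA mulrC.
have hL : linear (h : restrict (@tensr k A B) (ntens N X) -> X).
  move=> b t t'; rewrite hD; congr (_ + _); rewrite restrictZ.
  elim/ntens_ind: t => [n x|s s' IH IH']; last by rewrite scalerDr !hD IH IH' scalerDr.
  by rewrite tensr_npure !hE !scalerA mulr_algl mulr_algr.
by exists (mk_linear hL).
Qed.

Lemma linear_form (N : lmodType A) (n : N) : fin_gen N -> n != 0 ->
  exists l : {linear restrict (GRing.in_alg A) N -> k^o}, l n != 0.
Proof. by move=> gN; apply: (dual_basis_torsionless (dual_basis_falg gN)). Qed.

Lemma left_weakly_Gorenstein_factor : left_weakly_Gorenstein L -> left_weakly_Gorenstein A.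
Proof.
move=> /(left_weakly_GorensteinP (finite_tensalg A B)) tL.
apply/(left_weakly_GorensteinP (finite_falg A)) => N sN n nz.
have [l ln] := linear_form sN.1 nz.
have [h hE] := ncontract B^o l.
have sNB := sgp_ntens sN (dual_basis_regular B).
(* [n (x) 1] is nonzero because its contraction with [l] is the nonzero scalar [l n]. *)
have [|f fn] := tL _ sNB (npure n (1 : B^o)).
  apply: contraNneq ln => n0; have := hE n 1; rewrite n0 linear0.
  rewrite /GRing.scale /= mulr1 => /esym/eqP; rewrite scaler_eq0 oner_eq0 orbF.
  by [].
(* The value of [f] at [n (x) 1] lies in Lambda, which is projective over [A], so an [A]-linear form
   detects it. *)
have [g gn] := dual_basis_torsionless (dual_basis_tensl A B)
  (fn : (f (npure n (1 : B^o)) : restrict (tensl B) L^o) != 0).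
have qL : linear (fun m => g (f (npure m (1 : B^o)))).
  move=> a m m'; rewrite npureDl -tensl_npure linearD linearZ_LR /=.
  exact: linearP.
by exists (mk_linear qL).
Qed.

(* [W] behaves as the coinduced module Hom_k(Y, A), with [ev] its evaluation map. *)
Record coinduced (Y : lmodType B^c) (W : lmodType L) (ev : Y -> W -> A) : Prop := Coinduced {
  evDl : forall y y' w, ev (y + y') w = ev y w + ev y' w;
  evDr : forall y w w', ev y (w + w') = ev y w + ev y w';
  evA : forall y a w, ev y (tensl B a *: w) = a * ev y w;
  evB : forall y b w, ev (ract y b) w = ev y (tensr A b *: w);
  ev_inj : forall w, (forall y, ev y w = 0) -> w = 0;
  ev_ex : forall l : Y -> A, (forall y y', l (y + y') = l y + l y') ->
    (forall c y, l (kact c y) = c *: l y) -> exists w, forall y, ev y w = l y }.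

(** These are the [A]-linear maps from [Y (x)_B P] to [A], written without the tensor product.
    [coinduced_lift] and [coinduced_bimap] match them with Lambda-maps from [P] to the coinduced
    module. *)
Record bimap (Y : lmodType B^c) (P : lmodType L) (f : Y -> P -> A) : Prop := Bimap {
  biDl : forall y y' p, f (y + y') p = f y p + f y' p;
  biDr : forall y p p', f y (p + p') = f y p + f y p';
  biA : forall y a p, f y (tensl B a *: p) = a * f y p;
  biB : forall y b p, f (ract y b) p = f y (tensr A b *: p) }.

Section Coinduction.
Variables (Y : lmodType B^c) (W : lmodType L) (ev : Y -> W -> A).
Hypothesis hW : coinduced ev.

Lemma ev_inj2 w w' : (forall y, ev y w = ev y w') -> w = w'.
Proof.
move=> h; apply/eqP; rewrite -subr_eq0; apply/eqP/(ev_inj hW) => y.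
by apply: (addIr (ev y w')); rewrite -(evDr hW) subrK add0r.
Qed.

(** Each value exists by [ev_ex]; joint injectivity of the evaluations makes the choice linear. *)
Lemma coinduced_lift (P : lmodType L) (f : Y -> P -> A) : bimap f ->
  exists g : {linear P -> W}, forall y p, ev y (g p) = f y p.
Proof.
move=> hf; have /choice[g gE] p : exists w, forall y, ev y w = f y p.
  apply: (ev_ex hW) => [y y'|c y]; first exact: (biDl hf).
  by rewrite /kact (biB hf) -tensl_alg (biA hf) mulr_algl.
have gD p p' : g (p + p') = g p + g p'.
  by apply: ev_inj2 => y; rewrite (evDr hW) !gE (biDr hf).
have gL : linear g.
  move=> w p p'; rewrite gD; congr (_ + _).
  elim/tensalg_ind: w => [a b|w w' IH IH']; last by rewrite !scalerDl gD IH IH'.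
  apply: ev_inj2 => y; rewrite gE -tenslr -!scalerA.
  by rewrite (biA hf) (evA hW) -(biB hf) -(evB hW) gE.
by exists (mk_linear gL) => y p; rewrite /= gE.
Qed.

Lemma coinduced_bimap (P : lmodType L) (g : {linear P -> W}) : bimap (fun y p => ev y (g p)).
Proof.
split=> [y y' p|y p p'|y a p|y b p]; first exact: (evDl hW).
- by rewrite linearD (evDr hW).
- by rewrite linearZ_LR (evA hW).
- by rewrite linearZ_LR (evB hW).
Qed.

Lemma Ext_succ_at_bimap (M : lmodType L) (P : resolution M) n : Ext_succ_at P n W ->
  forall f : Y -> res_obj P n.+1 -> A, bimap f -> (forall y p, f y (res_d P n.+1 p) = 0) ->
  exists g : Y -> res_obj P n -> A, bimap g /\ forall y p, f y p = g y (res_d P n p).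
Proof.
move=> EP f hf fd; have [c cE] := coinduced_lift hf.
have [p|g gP] := EP c; first by apply: (ev_inj hW) => y; rewrite cE fd.
exists (fun y p => ev y (g p)); split=> [|y p]; first exact: coinduced_bimap.
by rewrite -cE gP.
Qed.

End Coinduction.

(** The last two fields make [X] the full [k]-dual of [Y], and [prB] matches the actions of [B]. *)
Record perfect_pairing (X : lmodType B) (Y : lmodType B^c) (pr : X -> Y -> k) : Prop :=
  PerfectPairing {
  prDl : forall x x' y, pr (x + x') y = pr x y + pr x' y;
  prDr : forall x y y', pr x (y + y') = pr x y + pr x y';
  prZ : forall c x y, pr (c%:A *: x) y = c * pr x y;
  prB : forall b x y, pr (b *: x) y = pr x (ract y b);
  pr_inj : forall x, (forall y, pr x y = 0) -> x = 0;
  pr_ex : forall l : Y -> k, (forall y y', l (y + y') = l y + l y') ->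
    (forall c y, l (kact c y) = c * l y) -> exists x, forall y, pr x y = l y }.

Lemma coinduced_ntens (X : lmodType B) (Y : lmodType B^c) (pr : X -> Y -> k) :
  perfect_pairing pr -> exists ev : Y -> ntens A^o X -> A,
    coinduced ev /\ forall y a x, ev y (npure a x) = pr x y *: a.
Proof.
move=> hp.
have /choice[ev evP] y : exists h : ntens A^o X -> A, {morph h : s t / s + t} /\
    forall a x, h (npure a x) = pr x y *: (a : A).
  apply: nlift_add => [a a' x|a x x'|c a x]; first exact: scalerDr.
    by rewrite (prDl hp) scalerDl.
  have -> : c%:A *: a = c *: (a : A) := mulr_algl c (a : A).
  by rewrite (prZ hp) scalerA mulrC.
have evE y a x : ev y (npure a x) = pr x y *: (a : A) by case: (evP y).
have evD y : {morph ev y : s t / s + t} by case: (evP y).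
exists ev; split; last exact: evE.
have [m [e [g eg]]] := dual_basis_falg (dual_basis_fin_gen (dual_basis_regular A)).
have egA a : a = \sum_i (g i a : k) *: (e i : A).
  rewrite [LHS]eg; apply: eq_bigr => i _.
  by rewrite restrictZ /GRing.scale /= mulr_algl.
split=> //.
- move=> y y'; elim/ntens_ind => [a x|s t IH IH']; last by rewrite !evD IH IH' addrACA.
  by rewrite !evE (prDr hp) scalerDl.
- move=> y a; elim/ntens_ind => [a' x|s t IH IH']; last by rewrite scalerDr !evD IH IH' mulrDr.
  by rewrite tensl_npure !evE; apply: scalerAr.
- move=> y b; elim/ntens_ind => [a' x|s t IH IH']; last by rewrite scalerDr !evD IH IH'.
  by rewrite tensr_npure !evE (prB hp).
(* A [k]-dual basis of [A] splits [w] into components [G i w] in [X]; pairing these with [y] gives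
   the coordinates of [ev y w]. *)
- have /choice[G GP] i := ncontract X (g i).
  have GE w : w = \sum_i npure (e i : A^o) (G i w).
    elim/ntens_ind: w => [a x|s t IH IH'].
      rewrite [a in LHS]eg npure_suml; apply: eq_bigr => i _.
      by rewrite restrictZ npureZ GP.
    rewrite [s in LHS]IH [t in LHS]IH' -big_split; apply: eq_bigr => i _.
    by rewrite linearD npureDr.
  have prG i w y : pr (G i w) y = g i (ev y w).
    elim/ntens_ind: w => [a x|s t IH IH'].
      by rewrite GP (prZ hp) evE -mulr_algl (linearZ_LR (g i) _ a) mulrC.
    by rewrite linearD (prDl hp) IH IH' evD linearD.
  move=> w w0; rewrite [w]GE big1 // => i _.
  suff -> : G i w = 0 by rewrite npure0.
  by apply: (pr_inj hp) => y; rewrite prG w0 linear0.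
move=> l lD lZ.
(* Each coordinate of [l] is a [k]-form on [Y], hence represented by an element of [X]. *)
have /choice[x xP] i : exists x, forall y, pr x y = g i (l y).
  apply: (pr_ex hp) => [y y'|c y]; first by rewrite lD linearD.
  by rewrite lZ -mulr_algl (linearZ_LR (g i) c (l y)).
exists (\sum_i npure (e i : A^o) (x i)) => y.
have ev0 : ev y 0 = 0 by apply: (addrI (ev y 0)); rewrite -evD !addr0.
rewrite (big_morph (ev y) (evD y) ev0) [RHS]egA.
by apply: eq_bigr => i _; rewrite evE xP.
Qed.

End WeaklyGorensteinTensor.

(** * Linear forms, and the [k]-duals of left and right modules *)

Section Forms.
Variables (k : fieldType) (V : lmodType k).

Record kform := Kform { kform_fun :> V -> k;
  kform_linear : forall c x y, kform_fun (c *: x + y) = c * kform_fun x + kform_fun y }.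

Lemma kform_ext (f g : kform) : f =1 g -> f = g.
Proof.
case: f g => [f fL] [g gL] /= /funext fg; case: g / fg in gL *.
by congr Kform; apply: Prop_irrelevance.
Qed.

HB.instance Definition _ := gen_eqMixin kform.
HB.instance Definition _ := gen_choiceMixin kform.

Lemma kform_of (f : V -> k) : (forall x y, f (x + y) = f x + f y) ->
  (forall c x, f (c *: x) = c * f x) -> exists g : kform, g =1 f.
Proof.
move=> fD fZ; have fL c x y : f (c *: x + y) = c * f x + f y by rewrite fD fZ.
by exists (Kform fL).
Qed.

Lemma kformD (f : kform) x y : f (x + y) = f x + f y.
Proof. by rewrite -{1}[x]scale1r kform_linear mul1r. Qed.
Lemma kformZ (f : kform) c x : f (c *: x) = c * f x.
Proof.
have f0 : f 0 = 0 by apply: (addrI (f 0)); rewrite -kformD !addr0.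
by rewrite -[c *: x]addr0 kform_linear f0 addr0.
Qed.

Lemma kform0 (f : kform) : f 0 = 0.
Proof. by apply: (addrI (f 0)); rewrite -kformD !addr0. Qed.

Lemma kform_dual_basis n (e : 'I_n -> V) (g : 'I_n -> {linear V -> k^o}) (f : kform) x :
  (forall y, y = \sum_i (g i y : k) *: e i) -> f x = \sum_i f (e i) * g i x.
Proof.
move=> eg; rewrite {1}[x]eg (big_morph f (kformD f) (kform0 f)).
by apply: eq_bigr => i _; rewrite kformZ mulrC.
Qed.

Lemma kform_zero_linear c (x y : V) : 0 = c * 0 + 0 :> k.
Proof. by rewrite mulr0 addr0. Qed.
Definition kform_zero := Kform kform_zero_linear.

Lemma kform_add_linear (f g : kform) c x y :
  f (c *: x + y) + g (c *: x + y) = c * (f x + g x) + (f y + g y).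
Proof. by rewrite !kform_linear mulrDr addrACA. Qed.
Definition kform_add f g := Kform (kform_add_linear f g).

Lemma kform_opp_linear (f : kform) c x y : - f (c *: x + y) = c * - f x + - f y.
Proof. by rewrite kform_linear opprD mulrN. Qed.
Definition kform_opp f := Kform (kform_opp_linear f).

Lemma kform_addA : associative kform_add.
Proof. by move=> f g h; apply: kform_ext => x /=; rewrite addrA. Qed.
Lemma kform_addC : commutative kform_add.
Proof. by move=> f g; apply: kform_ext => x /=; rewrite addrC. Qed.
Lemma kform_add0 : left_id kform_zero kform_add.
Proof. by move=> f; apply: kform_ext => x /=; rewrite add0r. Qed.
Lemma kform_addN : left_inverse kform_zero kform_opp kform_add.
Proof. by move=> f; apply: kform_ext => x /=; rewrite addNr. Qed.

HB.instance Definition _ :=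
  GRing.isZmodule.Build kform kform_addA kform_addC kform_add0 kform_addN.

Lemma kform_sum (I : finType) (f : I -> kform) x : (\sum_i f i) x = \sum_i f i x.
Proof. exact: (big_morph (fun g : kform => g x)). Qed.

End Forms.

Section Duals.
Variables (k : fieldType) (B : falgType k).

Definition conv_alg (c : k) : B^c := (c%:A : B).
Lemma conv_alg_is_zmod_morphism : zmod_morphism conv_alg.
Proof. exact: (rmorphB (GRing.in_alg B)). Qed.
Lemma conv_alg_is_monoid_morphism : monoid_morphism conv_alg.
Proof.
split=> [|c c']; first exact: scale1r.
by rewrite /conv_alg mulrC; apply: (rmorphM (GRing.in_alg B) c' c).
Qed.
HB.instance Definition _ :=
  GRing.isZmodMorphism.Build k B^c conv_alg conv_alg_is_zmod_morphism.
HB.instance Definition _ :=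
  GRing.isMonoidMorphism.Build k B^c conv_alg conv_alg_is_monoid_morphism.

Lemma finite_conv : fin_gen (restrict conv_alg (B^c)^o).
Proof.
have [n [e eP]] := finite_falg B; exists n, e => m; have [c cP] := eP m.
exists c; rewrite [LHS]cP; apply: eq_bigr => i _.
by rewrite [LHS]mulr_algl; apply: esym; apply: mulr_algr.
Qed.

Section LeftDual.
Variable Y : lmodType B^c.

Definition ldual : Type := kform (restrict conv_alg Y).
HB.instance Definition _ := GRing.Zmodule.on ldual.

Lemma ractZ (c : k) (y : Y) (b : B) : ract (kact c y) b = kact c (ract y b).
Proof. by rewrite /kact !ractA mulr_algl mulr_algr. Qed.

Lemma ldual_linear (b : B) (f : ldual) c (y y' : restrict conv_alg Y) :
  f (ract (c *: y + y' : Y) b) = c * f (ract y b) + f (ract y' b).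
Proof.
rewrite ractDl.
have -> : ract (c *: y : Y) b = c *: (ract y b : restrict conv_alg Y).
  exact: ractZ.
exact: kform_linear.
Qed.
Definition ldual_scale (b : B) (f : ldual) : ldual := Kform (ldual_linear b f).

Lemma ldual_scaleA b b' f : ldual_scale b (ldual_scale b' f) = ldual_scale (b * b') f.
Proof. by apply: kform_ext => y /=; rewrite ractA. Qed.
Lemma ldual_scale1 : left_id 1 ldual_scale.
Proof. by move=> f; apply: kform_ext => y /=; rewrite ract1. Qed.
Lemma ldual_scaleDr : right_distributive ldual_scale +%R.
Proof. by move=> b f g; apply: kform_ext. Qed.
Lemma ldual_scaleDl f : {morph ldual_scale^~ f : b b' / b + b'}.
Proof. by move=> b b'; apply: kform_ext => y /=; rewrite ractDr kformD. Qed.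

HB.instance Definition _ := GRing.Zmodule_isLmodule.Build B ldual
  ldual_scaleA ldual_scale1 ldual_scaleDr ldual_scaleDl.

Lemma ldual_pairing : perfect_pairing (fun (f : ldual) (y : Y) => f y).
Proof.
split=> // [f y y'|c f y|f f0|l lD lZ]; first exact: kformD.
- exact: kformZ.
- exact: kform_ext.
by have [g gl] := kform_of (V := restrict conv_alg Y) lD lZ; exists g.
Qed.

Lemma fin_gen_ldual : fin_gen Y -> fin_gen ldual.
Proof.
move=> /(fin_gen_restrict finite_conv)/dual_basis_field[n [e [g eg]]].
have /choice[h hP] i := kform_of (V := restrict conv_alg Y) (f := g i)
  (linearD (g i)) (linearZ_LR (g i)).
exists n, h => f; exists (fun i => (f (e i))%:A).
apply: kform_ext => y; rewrite kform_sum [LHS](kform_dual_basis f y eg).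
by apply: eq_bigr => i _; rewrite -hP -kformZ.
Qed.

End LeftDual.

Section RightDual.
Variable X : lmodType B.

Definition rdual : Type := kform (restrict (GRing.in_alg B) X).
HB.instance Definition _ := GRing.Zmodule.on rdual.

Lemma rdual_linear (b : B) (f : rdual) c (x x' : restrict (GRing.in_alg B) X) :
  f (b *: (c *: x + x' : X)) = c * f (b *: (x : X)) + f (b *: (x' : X)).
Proof.
rewrite scalerDr.
have -> : b *: (c *: x : X) = c *: (b *: (x : X) : restrict (GRing.in_alg B) X).
  by rewrite [LHS]scalerA [RHS]scalerA mulr_algl mulr_algr.
exact: kform_linear.
Qed.
Definition rdual_scale (b : B^c) (f : rdual) : rdual := Kform (rdual_linear b f).

Lemma rdual_scaleA b b' f : rdual_scale b (rdual_scale b' f) = rdual_scale (b * b') f.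
Proof. by apply: kform_ext => x /=; rewrite scalerA. Qed.
Lemma rdual_scale1 : left_id 1 rdual_scale.
Proof. by move=> f; apply: kform_ext => x /=; rewrite scale1r. Qed.
Lemma rdual_scaleDr : right_distributive rdual_scale +%R.
Proof. by move=> b f g; apply: kform_ext. Qed.
Lemma rdual_scaleDl f : {morph rdual_scale^~ f : b b' / b + b'}.
Proof. by move=> b b'; apply: kform_ext => x /=; rewrite scalerDl kformD. Qed.

HB.instance Definition _ := GRing.Zmodule_isLmodule.Build B^c rdual
  rdual_scaleA rdual_scale1 rdual_scaleDr rdual_scaleDl.

End RightDual.

(** This is biduality for the finite-dimensional space [B]: by a dual basis, forms separate its
    elements and every functional on [D(B)] is an evaluation. *)
Lemma rdual_pairing : perfect_pairing (fun (b : B^o) (f : rdual B^o) => f b).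
Proof.
have [n [e [g eg]]] := dual_basis_falg (dual_basis_fin_gen (dual_basis_regular B)).
have /choice[h hP] i := kform_of (f := g i) (linearD (g i)) (linearZ_LR (g i)).
split=> // [b b' f|c b f|b fb|l lD lZ]; first exact: kformD.
- exact: kformZ.
- rewrite [b]eg big1 // => i _; have := fb (h i).
  by rewrite hP => ->; rewrite scale0r.
have l0 : l 0 = 0 by apply: (addrI (l 0)); rewrite -lD !addr0.
exists (\sum_i l (h i) *: (e i : restrict (GRing.in_alg B) B^o)) => f.
rewrite (big_morph f (kformD f) (kform0 f)).
have fE : f = \sum_i kact (f (e i)) (h i : rdual B^o).
  apply: kform_ext => x; rewrite kform_sum [LHS](kform_dual_basis f x eg).
  by apply: eq_bigr => i _; rewrite -hP -kformZ.
rewrite [in RHS]fE (big_morph l lD l0); apply: eq_bigr => i _.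
by rewrite kformZ lZ mulrC.
Qed.

Lemma fin_gen_rdual : fin_gen (rdual B^o).
Proof.
have [n [e [g eg]]] := dual_basis_falg (dual_basis_fin_gen (dual_basis_regular B)).
have /choice[h hP] i := kform_of (f := g i) (linearD (g i)) (linearZ_LR (g i)).
exists n, h => f; exists (fun i => conv_alg (f (e i))).
apply: kform_ext => x; rewrite kform_sum [LHS](kform_dual_basis f x eg).
by apply: eq_bigr => i _; rewrite -hP -kformZ.
Qed.

End Duals.

(** * Ascent to the tensor product *)

Section Coefficients.
Variable R : pzRingType.

(** A stretch of the long exact sequence: a lift [g] of [c] to [E] has [g d] with values in [K], a
    cocycle one degree higher; bounding it by [v] makes [g - i v] a cocycle into [E]. *)
Lemma Ext_succ_at_coker (M : lmodType R) (P : resolution M) (K E W : lmodType R)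
  (i : {linear K -> E}) (p : {linear E -> W}) n : short_exact i p ->
  Ext_succ_at P n.+1 K -> Ext_succ_at P n E -> Ext_succ_at P n W.
Proof.
move=> ex EK EE c cd; case: (ex) => ii ps ip.
have [g gP] := proj_lift (g := p) (f := c) (@res_projective _ _ P n.+1) (fun x => ps (c x)).
have [q|u uP] := factor_inj (f := g \o res_d P n.+1) ii; first by apply/ip; rewrite /= gP.
have [q|v vP] := EK u; first by apply: ii; rewrite uP /= res_dd !linear0.
have [q|b bP] := EE (g \- (i \o v)); first by rewrite /= -vP uP subrr.
exists (p \o b) => q; rewrite /= -bP /= linearB gP.
by rewrite [X in _ - X](short_exact0 ex) subr0.
Qed.

Lemma Ext_lift (M : lmodType R) (P : resolution M) (K E W : lmodType R)
  (i : {linear K -> E}) (p : {linear E -> W}) (g : {linear M -> W}) : short_exact i p ->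
  Ext_succ_at P 0 K -> exists h : {linear M -> E}, forall m, p (h m) = g m.
Proof.
move=> ex EK; case: (ex) => ii ps ip.
have [f fP] := proj_lift (g := p) (f := g \o res_aug P) (@res_projective _ _ P 0)
  (fun x => ps _).
have [q|u uP] := factor_inj (f := f \o res_d P 0) ii.
  by apply/ip; rewrite /= fP /= res_aug_d linear0.
have [q|v vP] := EK u; first by apply: ii; rewrite uP /= res_dd !linear0.
have [x /res_exact0[q <-]|h hP] := factor_surj (f := f \- (i \o v)) (@res_aug_surj _ _ P).
  by rewrite /= -vP uP subrr.
exists h => m; have [x <-] := res_aug_surj P m.
by rewrite hP /= linearB fP [X in _ - X](short_exact0 ex) subr0.
Qed.

Lemma noetherian_ker (M N : lmodType R) (f : {linear M -> N}) : noetherian R ->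
  fin_gen M -> fin_gen (ker f).
Proof. by move=> nR gM; apply: nR gM (@ker_inc_inj _ _ _ f). Qed.

Lemma res_fin_gen (M : lmodType R) (P : resolution M) : fin_gen M.
Proof. exact: fin_gen_surj (dual_basis_fin_gen (res_dual_basis P 0)) (@res_aug_surj _ _ P). Qed.

Lemma res_zero (M : lmodType R) (P : resolution M) :
  (forall x : res_obj P 0, x = 0) -> forall m : M, m = 0.
Proof.
by move=> P0 m; have [x <-] := res_aug_surj P m; rewrite [x]P0 linear0.
Qed.

End Coefficients.

Section Ascent.
Variables (k : fieldType) (A B : falgType k).
Hypothesis hB : finite_gldim B.
Local Notation L := (tensalg A B).

Lemma Ext_succ_at_ntens (M : lmodType L) (P : resolution M) (X : lmodType B) n :
  semi_Gorenstein_projective M -> fin_gen X -> Ext_succ_at P n (ntens A^o X).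
Proof.
move=> [_ EM] gX; have [d /(_ X gX)[Q Q0]] := hB.
have {}Q0 i : (d.+1 <= i)%N -> forall x : res_obj Q i, x = 0 by apply: Q0.
(* Induction on the number of possibly nonzero terms of the resolution; with none left, [X = 0].
   Otherwise [A (x) X] is the quotient of a Lambda-projective by [A (x) K], with [K] the first
   syzygy of [X]. *)
elim: d.+1 X gX Q Q0 n => {d} [|d IH] X gX Q Q0 n.
  move=> c _; exists \0 => q.
  have X0 := res_zero (Q0 0%N isT).
  elim/ntens_ind: (c q) => [a x|s t -> ->]; last by rewrite addr0.
  by rewrite [x]X0 npure0.
have ex := short_exact_ntens A^o gX (short_exact_ker (@res_aug_surj _ _ Q)).
apply: Ext_succ_at_coker ex _ _.
  exact: (IH _ (res_fin_gen (shift Q)) (shift Q) (fun i => Q0 i.+1) n.+1).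
apply: Ext_succ_at_dual_basis (EM n P) _.
exact: dual_basis_ntens (dual_basis_regular A) (res_dual_basis Q 0).
Qed.

(** This is the case [Y = B], where [B (x)_B P] is [P] itself; putting [y = 1] recovers [c]. *)
Lemma regular_bimap (P : lmodType L) (c : {linear restrict (tensl B) P -> A^o}) :
  bimap (fun (y : (B^c)^o) (p : P) => c (tensr A (y : B) *: p) : A).
Proof.
split=> [y y' p|y p p'|y a p|y b p].
- by rewrite rmorphD scalerDl linearD.
- by rewrite scalerDr linearD.
- by rewrite scalerA tensrl -tenslr -scalerA (linearZ_LR c).
- by rewrite scalerA -rmorphM.
Qed.

Lemma sgp_restrict (M : lmodType L) : semi_Gorenstein_projective M ->
  semi_Gorenstein_projective (restrict (tensl B) M).
Proof.
move=> sM; have hL := dual_basis_tensl A B.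
split; first exact: fin_gen_restrict (dual_basis_fin_gen hL) sM.1.
move=> n; have [P] := resolution_exists (noetherian_finite (finite_tensalg A B)) sM.1.
apply: (Ext_succ_indep (P := restrict_res hL P)) => c cd.
have gY := dual_basis_fin_gen (dual_basis_regular B^c).
have [ev [hev _]] := coinduced_ntens A (ldual_pairing (B^c)^o).
have EP := Ext_succ_at_ntens (P := P) (n := n) sM (fin_gen_ldual gY).
have [y p|g [hg gE]] := Ext_succ_at_bimap hev EP (regular_bimap c).
  by rewrite -linearZ_LR; apply: cd.
have gL : linear (fun p : restrict (tensl B) (res_obj P n) => g (1 : B) p : A^o).
  by move=> a p p'; rewrite (biDr hg) (biA hg).
exists (mk_linear gL) => p /=; rewrite -gE rmorph1 scale1r.
by [].
Qed.

Lemma torsionless_tensalg (M : lmodType L) : semi_Gorenstein_projective M ->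
  torsionless (restrict (tensl B) M) -> torsionless M.
Proof.
move=> sM tM m /tM[f fm].
have [P] := resolution_exists (noetherian_finite (finite_tensalg A B)) sM.1.
have gY := dual_basis_fin_gen (dual_basis_regular B^c).
have [ev [hev _]] := coinduced_ntens A (ldual_pairing (B^c)^o).
have gX := fin_gen_ldual gY.
have [g gE] := coinduced_lift hev (regular_bimap f).
have [s [p ps]] := free_cover gX.
have ex := short_exact_ntens A^o gX (short_exact_ker ps).
have gK : fin_gen (ker p).
  apply: noetherian_ker (noetherian_finite (finite_falg B)) _.
  exact: dual_basis_fin_gen (dual_basis_free _ s).
have [h hP] := Ext_lift g ex (Ext_succ_at_ntens (P := P) sM gK).
have [|q qP] := dual_basis_torsionless
  (dual_basis_ntens (dual_basis_regular A) (dual_basis_free B s)) (m := h m).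
  (* [f m] is the evaluation of [g m] at 1, and [g m] is the image of [h m]; so [h m = 0] would
     force [f m = 0]. *)
  apply: contraNneq fm => hm; have := gE (1 : B) m.
  rewrite rmorph1 scale1r => <-; rewrite -hP hm linear0.
  by apply/eqP; apply: (addrI (ev (1 : B) 0)); rewrite -(evDr hev) !addr0.
by exists (q \o h).
Qed.

Lemma left_weakly_Gorenstein_tensalg : left_weakly_Gorenstein A -> left_weakly_Gorenstein L.
Proof.
move=> /(left_weakly_GorensteinP (finite_falg A)) tA.
apply/(left_weakly_GorensteinP (finite_tensalg A B)) => M sM.
exact/torsionless_tensalg/tA/sgp_restrict.
Qed.

End Ascent.

(** * The functor (A (x) Y) (x)_Lambda M *)

Section TensorOver.
Variables (k : fieldType) (A B : falgType k) (Y : lmodType B^c).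
Local Notation L := (tensalg A B).

Section Universal.
Variable M : lmodType L.

(** The factor [A] can be absorbed into [M], so these elements span additively, and the module is
    [Y (x)_B M] with [A] acting on [M]. *)
Definition tau (y : Y) (m : M) : tensover Y M := opure (mpure (1 : A) y) m.

Lemma tauDl y y' m : tau (y + y') m = tau y m + tau y' m.
Proof. by rewrite /tau mpureDr; apply: pureDl. Qed.
Lemma tauDr y m m' : tau y (m + m') = tau y m + tau y m'.
Proof. exact: pureDr. Qed.
Lemma tau_pure a b y m : tau y (tpure a b *: m) = opure (mpure a (ract y b)) m.
Proof.
rewrite -[LHS](@pureM _ _ _ _ _ (tpure a b)); congr opure.
by rewrite [LHS]mrightE mul1r.
Qed.
Lemma tauA a y m : tau y (tensl B a *: m) = a *: tau y m.
Proof. by rewrite tau_pure ract1 [RHS]oscaleE mleftE mulr1. Qed.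
Lemma tauB b y m : tau (ract y b) m = tau y (tensr A b *: m).
Proof. by rewrite tau_pure. Qed.

Lemma opure_tau a y m : opure (mpure a y) m = tau y (tensl B a *: m).
Proof. by rewrite tau_pure ract1. Qed.

Lemma tau_ind (P : tensover Y M -> Prop) : (forall y m, P (tau y m)) ->
  (forall s t, P s -> P t -> P (s + t)) -> forall t, P t.
Proof.
move=> Pt PD; elim/tensover_ind => // u m.
elim/tensmod_ind: u => [a y|u v IHu IHv]; first by rewrite opure_tau.
have -> : opure (u + v) m = opure u m + opure v m by apply: pureDl.
exact: PD.
Qed.

Lemma tau_lift_add (Z : zmodType) (f : Y -> M -> Z) :
  (forall y y' m, f (y + y') m = f y m + f y' m) ->
  (forall y m m', f y (m + m') = f y m + f y m') ->
  (forall b y m, f (ract y b) m = f y (tensr A b *: m)) ->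
  exists h : tensover Y M -> Z, {morph h : s t / s + t} /\ forall y m, h (tau y m) = f y m.
Proof.
move=> fDl fDr fB.
pose g m (u : tensmod A Y) := tens_lift (fun a y => f y (tensl B a *: m)) u.
have gb m : balanced (fun (c : k) (a : A) => c *: a) (@kact k B Y)
    (fun a y => f y (tensl B a *: m)).
  split=> [a a' y|a y y'|c a y]; [by rewrite rmorphD scalerDl fDr|exact: fDl|].
  by rewrite /kact fB scalerA tensrl -tpureZ.
have gD m : {morph g m : u v / u + v} := tens_liftD (gb m).
have gE m a y : g m (mpure a y) = f y (tensl B a *: m) := tens_liftE _ _ (gb m).
have hb : balanced (fun (x : L) (u : tensmod A Y) => (x : L^c) *: u)
    (fun (x : L) (m : M) => x *: m) (fun u m => g m u).
  split=> [u v m|u m m'|x u m]; first exact: gD.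
    elim/tensmod_ind: u => [a y|u v IHu IHv]; first by rewrite !gE scalerDr fDr.
    by rewrite !gD IHu IHv addrACA.
  elim/tensmod_ind: u => [a y|u v IHu IHv]; last by rewrite scalerDr !gD IHu IHv.
  elim/tensalg_ind: x => [a' b|x x' IHx IHx'].
    have -> : (tpure a' b : L^c) *: mpure a y = mpure (a * a') (ract y b) by apply: mrightE.
    by rewrite !gE fB !scalerA tensrl tpureM mul1r.
  rewrite scalerDl gD IHx IHx' !gE -fDr -scalerDr.
  by rewrite -scalerDl.
exists (tens_lift (fun u m => g m u)); split=> [|y m]; first exact: tens_liftD.
by rewrite (tens_liftE _ _ hb) gE rmorph1 scale1r.
Qed.

Lemma tau_lift (Z : lmodType A) (f : Y -> M -> Z) :
  (forall y y' m, f (y + y') m = f y m + f y' m) ->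
  (forall y m m', f y (m + m') = f y m + f y m') ->
  (forall a y m, f y (tensl B a *: m) = a *: f y m) ->
  (forall b y m, f (ract y b) m = f y (tensr A b *: m)) ->
  exists h : {linear tensover Y M -> Z}, forall y m, h (tau y m) = f y m.
Proof.
move=> fDl fDr fA fB; have [h [hD hE]] := tau_lift_add fDl fDr fB.
have hL : linear h.
  move=> a s t; rewrite hD; congr (_ + _).
  elim/tau_ind: s => [y m|s s' IH IH']; last by rewrite scalerDr !hD IH IH' scalerDr.
  by rewrite -tauA !hE fA.
by exists (mk_linear hL).
Qed.

Lemma tau0 y : tau y 0 = 0.
Proof. by apply: (addrI (tau y 0)); rewrite -tauDr !addr0. Qed.

Lemma tau_bimap (c : {linear tensover Y M -> A^o}) : bimap (fun y m => c (tau y m) : A).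
Proof.
split=> [y y' m|y m m'|y a m|y b m]; first by rewrite tauDl linearD.
- by rewrite tauDr linearD.
- by rewrite tauA linearZ_LR.
- by rewrite tauB.
Qed.

End Universal.

Section Functor.
Variables M M' : lmodType L.

(** This form accepts homotopies that are only [B]-linear, as those coming from projectivity over
    [B] are. *)
Lemma tau_map_add (f : {linear restrict (@tensr k A B) M -> restrict (@tensr k A B) M'}) :
  exists h : tensover Y M -> tensover Y M', {morph h : s t / s + t} /\
    forall y m, h (tau y m) = tau y (f m : M').
Proof.
apply: tau_lift_add => [y y' m|y m m'|b y m]; first exact: tauDl.
  by rewrite linearD -tauDr.
rewrite tauB; congr tau; apply: esym; exact: (linearZ_LR f b m).
Qed.

Lemma tau_map_proof (f : {linear M -> M'}) :
  exists h : {linear tensover Y M -> tensover Y M'},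
    forall y m, h (tau y m) = tau y (f m).
Proof.
apply: tau_lift => [y y' m|y m m'|a y m|b y m]; first exact: tauDl.
- by rewrite linearD tauDr.
- by rewrite linearZ_LR tauA.
- by rewrite linearZ_LR tauB.
Qed.

Definition tau_map f : {linear tensover Y M -> tensover Y M'} :=
  projT1 (cid (tau_map_proof f)).
Lemma tau_mapE f y m : tau_map f (tau y m) = tau y (f m).
Proof. exact: (projT2 (cid (tau_map_proof f))). Qed.

End Functor.

Hypothesis gY : fin_gen Y.

Lemma dual_basis_tensover (P : lmodType L) : dual_basis P -> dual_basis (tensover Y P).
Proof.
move=> [n [e [f ef]]].
have [m [y0 [g yg]]] := dual_basis_field (fin_gen_restrict (finite_conv B) gY).
have gZ s c (y : Y) : g s (kact c y) = c * g s y := linearZ_LR (g s) c y.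
(* Under [Y (x)_B Lambda = A (x) Y], a [k]-dual basis [y0, g] of [Y] gives an [A]-dual basis; this
   formula is its coordinate [s] on [y (x) (a (x) b)]. *)
have hb s y : balanced (fun (c : k) (a : A) => c *: a) (fun (c : k) (b : B) => c *: b)
    (fun a b => (g s (ract y b) : k) *: a).
  split=> [a a' b|a b b'|c a b]; first by rewrite scalerDr.
    by rewrite ractDr linearD scalerDl.
  rewrite -[c *: b]mulr_algr -ractA.
  by rewrite [g s (ract _ c%:A)]gZ scalerA mulrC.
pose E s y (w : L) : A := tens_lift (fun a b => (g s (ract y b) : k) *: a) w.
have ED s y : {morph E s y : w w' / w + w'} := tens_liftD (hb s y).
have EE s y a b : E s y (tpure a b) = (g s (ract y b) : k) *: a := tens_liftE _ _ (hb s y).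
have /choice[h hP] (ij : 'I_n * 'I_m) : exists h : {linear tensover Y P -> A^o},
    forall y p, h (tau y p) = E ij.2 y (f ij.1 p).
  apply: tau_lift => [y y' p|y p p'|a y p|b y p].
  - elim/tensalg_ind: (f ij.1 p : L) => [a b|w w' IH IH']; last by rewrite !ED IH IH' addrACA.
    by rewrite !EE ractDl linearD scalerDl.
  - by rewrite linearD ED.
  - rewrite linearZ_LR; elim/tensalg_ind: (f ij.1 p : L) => [a' b|w w' IH IH'].
      by rewrite [_ *: _ in LHS]tpureM mul1r !EE; apply: scalerAr.
    by rewrite scalerDr !ED IH IH' scalerDr.
  - rewrite linearZ_LR; elim/tensalg_ind: (f ij.1 p : L) => [a b'|w w' IH IH'].
      by rewrite [_ *: _ in RHS]tpureM mul1r !EE ractA.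
    by rewrite scalerDr !ED IH IH'.
apply: (@dual_basis_fin _ _ _ (fun ij : 'I_n * 'I_m => tau (y0 ij.2 : Y) (e ij.1)) h).
have main y w (q : P) : tau y (w *: q) = \sum_s E s y w *: tau (y0 s : Y) q.
  elim/tensalg_ind: w => [a b|w w' IH IH']; last first.
    rewrite scalerDl tauDr IH IH' -big_split; apply: eq_bigr => s _.
    by rewrite ED scalerDl.
  rewrite -[in LHS]tensrl -scalerA -tauB tauA.
  have t0 : tau (0 : Y) q = 0 by apply: (addrI (tau 0 q)); rewrite -tauDl !addr0.
  have -> : ract y b = \sum_s kact (g s (ract y b)) (y0 s : Y) := yg (ract y b).
  rewrite (big_morph (fun y => tau y q) (fun y y' => tauDl y y' q) t0) scaler_sumr.
  apply: eq_bigr => s _.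
  by rewrite EE /kact tauB -tensl_alg tauA scalerA mulr_algr.
elim/tau_ind => [y p|s t IH IH']; last first.
  rewrite {1}IH {1}IH' -big_split; apply: eq_bigr => ij _.
  by rewrite linearD scalerDl.
under eq_bigr do rewrite hP.
rewrite -(pair_bigA _ (fun i s => E s y (f i p) *: tau (y0 s : Y) (e i))) /=.
rewrite [p in LHS]ef (big_morph (tau y) (@tauDr _ y) (@tau0 _ y)).
by apply: eq_bigr => i _; apply: main.
Qed.

Section TensorOverResolution.
Variables (M : lmodType L) (P : resolution M).
Hypothesis hM : projective (restrict (@tensr k A B) M).

Lemma tau_res_surj t : exists s, tau_map (res_aug P) s = t.
Proof.
elim/tau_ind: t => [y m|t t' [s <-] [s' <-]]; last by exists (s + s'); rewrite linearD.
by have [p <-] := res_aug_surj P m; exists (tau y p); rewrite tau_mapE.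
Qed.

(** Projectivity of [M] over [B] gives the resolution a [B]-linear contraction, which survives
    [Y (x)_B -]; higher degrees are handled in the same way. *)
Lemma tau_res_exact0 t :
  tau_map (res_aug P) t = 0 <-> exists s, tau_map (res_d P 0) s = t.
Proof.
have [s [h [augs h0 _]]] := contraction (restrict_res (dual_basis_tensr A B) P) hM.
have [s' [s'D s'E]] := tau_map_add s.
have [h' [h'D h'E]] := tau_map_add (h 0).
have e u : u = tau_map (res_d P 0) (h' u) + s' (tau_map (res_aug P) u).
  elim/tau_ind: u => [y x|u u' IH IH'].
    by rewrite tau_mapE h'E s'E tau_mapE -tauDr; congr tau; apply: h0.
  by rewrite linearD h'D s'D linearD addrACA -IH -IH'.
split=> [t0|[u <-]].
  have s'0 : s' 0 = 0 by apply: (addrI (s' 0)); rewrite -s'D !addr0.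
  by exists (h' t); rewrite [RHS]e t0 s'0 addr0.
elim/tau_ind: u => [y x|z z' IH IH']; last by rewrite !linearD IH IH' addr0.
by rewrite !tau_mapE res_aug_d tau0.
Qed.

Lemma tau_res_exact n t :
  tau_map (res_d P n) t = 0 <-> exists s, tau_map (res_d P n.+1) s = t.
Proof.
have [s [h [_ _ hS]]] := contraction (restrict_res (dual_basis_tensr A B) P) hM.
have [s' [s'D s'E]] := tau_map_add (h n).
have [h' [h'D h'E]] := tau_map_add (h n.+1).
have e u : u = tau_map (res_d P n.+1) (h' u) + s' (tau_map (res_d P n) u).
  elim/tau_ind: u => [y x|u u' IH IH'].
    by rewrite tau_mapE h'E s'E tau_mapE -tauDr; congr tau; apply: hS.
  by rewrite linearD h'D s'D linearD addrACA -IH -IH'.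
split=> [t0|[u <-]].
  have s'0 : s' 0 = 0 by apply: (addrI (s' 0)); rewrite -s'D !addr0.
  by exists (h' t); rewrite [RHS]e t0 s'0 addr0.
elim/tau_ind: u => [y x|z z' IH IH']; last by rewrite !linearD IH IH' addr0.
by rewrite !tau_mapE res_dd tau0.
Qed.

Definition tau_res : resolution (tensover Y M) :=
  @Resolution A (tensover Y M) (fun n => tensover Y (res_obj P n))
    (fun n => tau_map (res_d P n)) (tau_map (res_aug P))
    (fun n => (fg_projectiveP _).2 (dual_basis_tensover (res_dual_basis P n)))
    tau_res_surj tau_res_exact0 tau_res_exact.

End TensorOverResolution.

End TensorOver.

(** * Monic representations *)

Section Projectivity.
Variable R : pzRingType.

(** The map [1 - i r], with [i] the kernel inclusion, vanishes on the kernel and descends to a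
    section of the augmentation. *)
Lemma dual_basis_split_quotient (M : lmodType R) (P : resolution M)
  (r : {linear res_obj P 0 -> ker (res_aug P)}) :
  (forall z, r (ker_inc (res_aug P) z) = z) -> dual_basis M.
Proof.
move=> rK; have [x /ker_incP[z <-]|s sP] := factor_surj
  (f := idfun \- (ker_inc (res_aug P) \o r)) (@res_aug_surj _ _ P).
  by rewrite /= [r _]rK subrr.
apply: (dual_basis_retract (i := s) (r := res_aug P) _ (res_dual_basis P 0)) => m.
by have [x <-] := res_aug_surj P m; rewrite sP /= linearB [X in _ - X]ker_inc0 subr0.
Qed.

(** The tautological 1-cocycle [shift_aug P] takes values in the syzygy; a map bounding it retracts
    the syzygy inclusion. *)
Lemma Ext1_dual_basis (M : lmodType R) (P : resolution M) :
  Ext_succ_at P 0 (ker (res_aug P)) -> dual_basis M.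
Proof.
move=> EP; have [q|r rP] := EP (shift_aug P).
  by apply: ker_inc_inj; rewrite shift_augE res_dd linear0.
apply: (dual_basis_split_quotient (r := r)) => z.
by have [q <-] := res_aug_surj (shift P) z; rewrite shift_augE -rP.
Qed.

Lemma finite_gldim_Ext : finite_gldim R -> exists d : nat, forall M N : lmodType R,
  fin_gen M -> forall n, (d <= n)%N -> Ext_succ_vanishes n M N.
Proof.
move=> [d hd]; exists d => M N gM n dn; have [Q Q0] := hd M gM.
apply: (Ext_succ_indep (P := Q)) => c _; exists \0 => q.
by rewrite [q](Q0 n.+1) // linear0.
Qed.

End Projectivity.

Section MonicRepresentations.
Variables (k : fieldType) (A B : falgType k).
Hypothesis hB : finite_gldim B.
Local Notation L := (tensalg A B).

Let nL : noetherian L := noetherian_finite (finite_tensalg A B).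
Let hr := dual_basis_tensr A B.

Lemma sgp_Ext_restrict : left_weakly_Gorenstein L ->
  forall M : lmodType L, semi_Gorenstein_projective M ->
  forall (N : lmodType B) n, Ext_succ_vanishes n (restrict (@tensr k A B) M) N.
Proof.
move=> /(left_weakly_GorensteinP (finite_tensalg A B)) tL.
have [d hd] := finite_gldim_Ext hB.
have gr (M : lmodType L) : fin_gen M -> fin_gen (restrict (@tensr k A B) M) :=
  fin_gen_restrict (dual_basis_fin_gen hr).
(* M is a syzygy of a semi-Gorenstein-projective module, so a vanishing in degree n + 1
   for all such modules gives one in degree n. *)
suff h j : forall M : lmodType L, semi_Gorenstein_projective M ->
    forall (N : lmodType B) n, (d <= n + j)%N ->
    Ext_succ_vanishes n (restrict (@tensr k A B) M) N.
  by move=> M sM N n; apply: (h d) => //; apply: leq_addl.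
elim: j => [|j IH] M sM N n dn; first by apply: hd (gr M sM.1) _ _; rewrite addn0 in dn.
have [M' [sM' [Q [i [p [hQ ex]]]]]] :=
  linked_right (finite_tensalg A B) (tL _ sM) sM.
have [P] := resolution_exists (noetherian_finite (finite_falg B)) (gr M sM.1).
have exr : short_exact (restrict_linear (@tensr k A B) i) (restrict_linear (@tensr k A B) p) := ex.
apply: (Ext_succ_indep (P := P)).
by apply: (IH M' sM' N n.+1 _ (splice exr (dual_basis_restrict hr hQ) P)); rewrite addSnnS.
Qed.

Lemma sgp_monic (M : lmodType L) : left_weakly_Gorenstein L ->
  semi_Gorenstein_projective M -> monic_rep M.
Proof.
move=> wL sM; split; first exact: sM.1.
have gM := fin_gen_restrict (dual_basis_fin_gen hr) sM.1.
have [P] := resolution_exists (noetherian_finite (finite_falg B)) gM.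
apply/dual_basis_proj/(Ext1_dual_basis (P := P)).
exact: (sgp_Ext_restrict wL sM).
Qed.

Lemma sgp_tensover (M : lmodType L) (Y : lmodType B^c) :
  semi_Gorenstein_projective M -> projective (restrict (@tensr k A B) M) ->
  fin_gen Y -> semi_Gorenstein_projective (tensover Y M).
Proof.
move=> sM pM gY; have [P] := resolution_exists nL sM.1.
split=> [|n].
  apply: fin_gen_surj (@tau_res_surj _ _ _ Y _ P).
  exact/dual_basis_fin_gen/(dual_basis_tensover gY)/res_dual_basis.
apply: (Ext_succ_indep (P := tau_res gY P pM)) => c cd.
have [ev [hev _]] := coinduced_ntens A (ldual_pairing Y).
have EP := Ext_succ_at_ntens hB (P := P) (n := n) sM (fin_gen_ldual gY).
have [y p|g [hg gE]] := Ext_succ_at_bimap hev EP (tau_bimap c).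
  by have := cd (tau y p); rewrite /= tau_mapE.
(* The bounding bimap is turned back into an [A]-linear map on [Y (x)_B P]. *)
have [u uE] := tau_lift (Z := A^o) (biDl hg) (biDr hg) (fun a y => biA hg y a)
  (fun b y => biB hg y b).
exists u => t; elim/tau_ind: t => [y p|s t IH IH']; last by rewrite !linearD IH IH'.
by rewrite /= tau_mapE uE -gE.
Qed.

Lemma monic_sgp (M : lmodType L) :
  Mon (@semi_Gorenstein_projective A) M -> semi_Gorenstein_projective M.
Proof.
move=> [[gM pM] hM]; split=> // n; have [P] := resolution_exists nL gM.
have gY := fin_gen_rdual B; have [_ ET] := hM _ gY.
have [ev [hev _]] := coinduced_ntens A (rdual_pairing B).
apply: (Ext_succ_indep (P := P)) => c cd.
(* With [Y = D(B)] the coinduced module is [A (x) B]; [q] and [j] below compare it with Lambda. *)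
have [a a' b|a b b'|a' a b|b' a b|q qP] := nlift (N := A^o) (X := B^o) (Z := L^o)
  (f := fun a b => tpure a b : L).
- exact: tpureDl.
- exact: tpureDr.
- by rewrite /GRing.scale /= tpureM mul1r.
- by rewrite /GRing.scale /= tpureM mul1r.
have jL : linear (fun w : L^o => (w : L) *: npure (1 : A^o) (1 : B^o)).
  by move=> v w w'; rewrite scalerDl -scalerA.
pose j := mk_linear jL.
have qj w : q (j w) = w by rewrite linearZ_LR qP; apply: mulr1.
(* The adjunction turns [j \o c] into an [A]-linear cocycle on [D(B) (x)_B P]. A map bounding it is
   carried back to [u], and [q \o u] bounds [c]. *)
have hc := coinduced_bimap hev (j \o c).
have [f fE] := tau_lift (Z := A^o) (biDl hc) (biDr hc) (fun a y => biA hc y a)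
  (fun b y => biB hc y b).
have [t|g gE] := ET n (tau_res gY P pM) f.
  elim/tau_ind: t => [y p|s t IH IH']; last by rewrite !linearD IH IH' addr0.
  rewrite /= tau_mapE fE /= cd scale0r.
  by apply: (addrI (ev y 0)); rewrite -(evDr hev) !addr0.
have [u uE] := coinduced_lift hev (tau_bimap g).
exists (q \o u) => p /=; rewrite -[LHS]qj; congr (q _).
by apply: (ev_inj2 hev) => y; rewrite uE -fE gE /= tau_mapE.
Qed.

Lemma sgp_Mon : left_weakly_Gorenstein A -> forall M : lmodType L,
  semi_Gorenstein_projective M <-> Mon (@semi_Gorenstein_projective A) M.
Proof.
move=> wA M; split; last exact: monic_sgp.
move=> sM; have mM := sgp_monic (left_weakly_Gorenstein_tensalg hB wA) sM.
by split=> // Y; apply: sgp_tensover; case: mM.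
Qed.

End MonicRepresentations.

(** * Mapping cones *)

Section Cone.
Variable R : pzRingType.

Lemma dual_basis_prod (M N : lmodType R) :
  dual_basis M -> dual_basis N -> dual_basis (M * N)%type.
Proof.
move=> [a [e [f ef]]] [b [e' [f' ef']]].
apply: (@dual_basis_fin _ _ ('I_a + 'I_b)%type
  (fun s => match s with inl j => (e j, 0) | inr j => (0, e' j) end)
  (fun s => match s with inl j => f j \o proj1_lin _ _ | inr j => f' j \o proj2_lin _ _ end)).
move=> [x y]; rewrite big_sumType /=.
transitivity (pair_lin idfun \0 x + pair_lin \0 idfun y : (M * N)%type).
  by apply: injective_projections; rewrite /= ?addr0 ?add0r.
congr (_ + _); [rewrite {1}[x]ef | rewrite {1}[y]ef']; rewrite linear_sum;
  by apply: eq_bigr => j _; rewrite linearZ_LR.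
Qed.

Section ConeResolution.
Variables (K E M : lmodType R) (i : {linear K -> E}) (p : {linear E -> M}).
Hypothesis ex : short_exact i p.
Variables (P : resolution K) (Q : resolution E).
Variable F : forall n, {linear res_obj P n -> res_obj Q n}.
Hypothesis F0 : forall x, res_aug Q (F 0 x) = i (res_aug P x).
Hypothesis FS : forall n x, res_d Q n (F n.+1 x) = F n (res_d P n x).

(* The mapping cone of F, with the differential of P negated. *)
Definition cone_obj n : lmodType R :=
  if n is n'.+1 then (res_obj Q n'.+1 * res_obj P n')%type else res_obj Q 0.

Definition cone_d n : {linear cone_obj n.+1 -> cone_obj n} :=
  match n return {linear cone_obj n.+1 -> cone_obj n} with
  | 0 => sum_lin (res_d Q 0) (F 0)
  | n'.+1 => pair_lin (sum_lin (res_d Q n'.+1) (F n'.+1))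
               (\- res_d P n' \o proj2_lin (res_obj Q n'.+2) (res_obj P n'.+1))
  end.

Lemma cone_proj n : fg_projective (cone_obj n).
Proof.
case: n => [|n]; first exact: res_proj.
by apply/fg_projectiveP/dual_basis_prod; apply: res_dual_basis.
Qed.

Lemma cone_cycle n (q : res_obj Q n.+1) (x : res_obj P n) :
  (cycle x /\ res_d Q n q + F n x = 0) <-> exists y, cone_d n.+1 y = (q, x).
Proof.
split=> [[/cycleP[x' <-] h]|[[q' x'] [<- <-]]].
  have /res_exact[q' q'P] : res_d Q n (q + F n.+1 x') = 0 by rewrite linearD FS.
  by exists (q', - x'); rewrite /= !linearN opprK q'P addrK.
split; first by apply/cycleP; exists (- x'); rewrite linearN.
by rewrite linearD res_dd add0r FS linearN subrr.
Qed.

(** Since [i] is injective with cokernel [M], the cone of a chain map lifting [i] has homology [M]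
    in degree 0 only. *)
Definition cone : resolution M.
Proof.
refine (@Resolution R M cone_obj cone_d (p \o res_aug Q) cone_proj _ _ _).
- move=> m; case: ex => _ ps _; have [e <-] := ps m.
  by have [q <-] := res_aug_surj Q e; exists q.
- move=> q; split=> [pq|[[q' x] <-]]; last first.
    by rewrite /= linearD res_aug_d add0r F0 (short_exact0 ex).
  case: ex => _ _ /(_ (res_aug Q q))[/(_ pq)[z zq] _].
  have [x xz] := res_aug_surj P z.
  have /res_exact0[q' q'P] : res_aug Q (q - F 0 x) = 0.
    by rewrite linearB F0 xz zq subrr.
  by exists (q', x); rewrite /= q'P subrK.
- case=> [|n] [q x]; rewrite -cone_cycle /=.
    split=> [h|[]//]; split=> //.
    (* In the lowest degree [x] is an augmented cycle because
       [i (res_aug P x) = res_aug Q (F 0 x) = 0] and [i] is injective. *)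
    case: ex => ii _ _; apply: ii; rewrite linear0 -F0.
    have := congr1 (res_aug Q) h; rewrite linearD res_aug_d add0r linear0.
    by [].
  split=> [[h h']|[h ->]]; last by rewrite h oppr0.
  by split=> //; rewrite -[res_d P n x]opprK h' oppr0.
Defined.

End ConeResolution.

Lemma Ext_succ_projective (M N : lmodType R) (P : resolution M) n :
  projective M -> Ext_succ_at P n N.
Proof.
move=> pM c cd; have [s [h [_ _ hS]]] := contraction P pM; exists (c \o h n) => x.
by rewrite {1}[x]hS linearD cd add0r.
Qed.

Section ProductResolution.
Variables (M N : lmodType R) (P : resolution M) (Q : resolution N).

Let pairf (U U' V V' : lmodType R) (f : {linear U -> U'}) (g : {linear V -> V'}) :
  {linear (U * V)%type -> (U' * V')%type} :=
  pair_lin (f \o proj1_lin U V) (g \o proj2_lin U V).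

Definition res_prod : resolution (M * N)%type.
Proof.
refine (@Resolution R _ (fun n => (res_obj P n * res_obj Q n)%type)
  (fun n => pairf (res_d P n) (res_d Q n)) (pairf (res_aug P) (res_aug Q)) _ _ _ _).
- by move=> n; apply/fg_projectiveP/dual_basis_prod; apply: res_dual_basis.
- move=> [x y]; have [[p <-] [q <-]] := (res_aug_surj P x, res_aug_surj Q y).
  by exists (p, q).
- move=> [x y]; split=> [h|[[x' y'] <-]]; last by rewrite /= !res_aug_d.
  have [/res_exact0[x' xE] /res_exact0[y' yE]] := (congr1 fst h, congr1 snd h).
  by exists (x', y'); apply: injective_projections; rewrite /= ?xE ?yE.
- move=> n [x y]; split=> [h|[[x' y'] <-]]; last by rewrite /= !res_dd.
  have [/res_exact[x' xE] /res_exact[y' yE]] := (congr1 fst h, congr1 snd h).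
  by exists (x', y'); apply: injective_projections; rewrite /= ?xE ?yE.
Defined.

End ProductResolution.

Hypothesis nR : noetherian R.

Lemma sgp_projective (M : lmodType R) : dual_basis M -> semi_Gorenstein_projective M.
Proof.
move=> hM; split; first exact: dual_basis_fin_gen.
by move=> n P; apply: Ext_succ_projective; apply: dual_basis_proj.
Qed.

Lemma sgp_prod (M N : lmodType R) : semi_Gorenstein_projective M ->
  semi_Gorenstein_projective N -> semi_Gorenstein_projective (M * N)%type.
Proof.
move=> [gM EM] [gN EN].
have [P] := resolution_exists nR gM; have [Q] := resolution_exists nR gN.
split=> [|n]; first exact: res_fin_gen (res_prod P Q).
apply: (Ext_succ_indep (P := res_prod P Q)) => c cd.
have [p|f fP] := EM n P (c \o pair_lin idfun \0).
  by have := cd (p, 0); rewrite /= linear0.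
have [q|g gP] := EN n Q (c \o pair_lin \0 idfun).
  by have := cd (0, q); rewrite /= linear0.
exists (sum_lin f g) => -[p q]; rewrite /= -fP -gP /= -linearD.
by congr (c _); apply: injective_projections; rewrite /= ?addr0 ?add0r.
Qed.

(** The cone takes the place of the splice in [sgp_coker]. The [Q]-part of a cocycle is bounded by
    some [b], and the remainder [e] is a cocycle on [P]: in degree 0 it is a map on [K], which
    extends to [E], and in higher degrees it bounds. *)
Lemma sgp_quotient (K E M : lmodType R) (i : {linear K -> E}) (p : {linear E -> M}) :
  short_exact i p -> semi_Gorenstein_projective K -> semi_Gorenstein_projective E ->
  (forall f : {linear K -> R^o}, exists g : {linear E -> R^o}, forall z, g (i z) = f z) ->
  semi_Gorenstein_projective M.
Proof.
move=> ex [gK EK] [gE EE] ext; have [_ ps _] := ex.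
split; first exact: fin_gen_surj gE ps.
have [P] := resolution_exists nR gK; have [Q] := resolution_exists nR gE.
have [F [F0 FS]] := chain_map P Q i.
move=> n; apply: (Ext_succ_indep (P := cone ex F0 FS)) => c cd.
have [q|b bP] := EE n Q (c \o pair_lin idfun \0).
  by have := cd (q, 0); rewrite /= !linear0 addr0.
have cE q x : c (q, x) = b (res_d Q n q) + c (0, x).
  rewrite -bP /= -linearD; congr (c _).
  by apply: injective_projections; rewrite /= ?addr0 ?add0r.
pose e : {linear res_obj P n -> R^o} := (c \o pair_lin \0 idfun) \- (b \o F n).
have eE q x : c (q, x) = b (res_d Q n q + F n x) + e x.
  by rewrite cE /= linearD addrACA subrr addr0.
have ed x : e (res_d P n x) = 0.
  have := cd (0, - x); rewrite /= !linearN linear0 add0r opprK eE.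
  by rewrite linearN FS addNr linear0 add0r.
case: n => [|n] in c cd b bP cE e eE ed *.
  have [x /res_exact0[y <-]|f fP] := factor_surj (f := e) (@res_aug_surj _ _ P); first exact: ed.
  have [g gP] := ext f; exists (b \+ (g \o res_aug Q)) => -[q x].
  by rewrite eE /=; congr (_ + _); rewrite [res_aug Q _]linearD res_aug_d add0r F0 gP fP.
have [a aP] := EK n P e ed.
exists (sum_lin b (\- a)) => -[q x].
by rewrite eE aP /= linearN opprK.
Qed.

End Cone.

(** * Semisimplicity and the converse *)

Section Semisimplicity.
Variables (k : fieldType) (B : falgType k).

Lemma left_idealP (I : {vspace B}) :
  left_ideal I <-> forall b x, x \in I -> b * x \in I.
Proof.
split=> [hI b x xI|hI]; first by apply: (subvP hI); rewrite memv_mul ?memvf.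
by apply/prodvP => b x _; apply: hI.
Qed.

Lemma left_ideal_idempotent (I : {vspace B}) : left_ideal I ->
  (forall M : lmodType B, fin_gen M -> dual_basis M) ->
  exists2 e, e \in I & forall x, x \in I -> x * e = x.
Proof.
move=> /left_idealP hI proj.
(* [B / I], as the cokernel of the map from a free module given by a vector space basis of [I]. *)
pose p := coker_proj (comb (fun i : 'I_(\dim I) => (vbasis I)`_i : B^o)).
have pI x : p x = 0 <-> x \in I.
  rewrite coker_projP; split=> [[v <-]|xI].
    by apply: rpred_sum => i _; apply/hI/vbasis_mem/mem_nth; rewrite size_tuple.
  exists [ffun i => (coord (vbasis I) i x)%:A]; rewrite [RHS](coord_vbasis xI).
  by apply: eq_bigr => i _; rewrite ffunE;
    exact: (mulr_algl (coord (vbasis I) i x) ((vbasis I)`_i : B)).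
have gC := fin_gen_surj (dual_basis_fin_gen (dual_basis_regular B))
  (coker_proj_surj (f := comb (fun i : 'I_(\dim I) => (vbasis I)`_i : B^o))).
have [s sP] := dual_basis_proj (proj _ gC) (g := p) idfun (coker_proj_surj (f := _)).
(* The component of 1 in [I] for the splitting of [B -> B / I]; for [x] in [I],
   [x * s (p 1) = s (p x) = 0]. *)
exists (1 - s (p 1) : B) => [|x xI].
  by apply/pI; rewrite linearB sP subrr.
have x1 : x *: (1 : B^o) = x by apply: mulr1.
have xs : x * s (p 1) = s (p (x *: (1 : B^o))) by rewrite !linearZ_LR.
by rewrite mulrBr mulr1 xs x1 (pI x).2 // linear0 subr0.
Qed.

Lemma minimal_left_ideal_exists (I : {vspace B}) : left_ideal I -> I != 0%VS ->
  exists2 S, minimal_left_ideal S & (S <= I)%VS.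
Proof.
have [n] := ubnP (\dim I); elim: n I => // n IH I dI hI I0.
have [[J [hJ JI J0 nJI]]|none] := pselect (exists J, [/\ left_ideal J, (J <= I)%VS,
    J != 0%VS & J != I]).
  have [|S mS SJ] := IH J _ hJ J0; last by exists S => //; apply: subv_trans JI.
  rewrite ltnS in dI; apply: leq_trans dI; rewrite ltn_neqAle dimvS // andbT.
  by apply: contraNneq nJI => dJ; rewrite eqEdim JI dJ leqnn.
exists I => //; split=> // J hJ JI.
have [->|J0] := eqVneq J 0%VS; first by left.
right; apply: contrapT => /eqP nJI; apply: none; exists J; split=> //.
Qed.

(** Right multiplication by the idempotent [e] of a minimal left ideal [S] inside [I] projects [I]
    onto [S]; its kernel [J] in [I] is a left ideal of smaller dimension. *)
Lemma semisimple_of_projective :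
  (forall M : lmodType B, fin_gen M -> dual_basis M) -> semisimple_algebra B.
Proof.
move=> proj.
suff h (I : {vspace B}) : left_ideal I -> exists n (S : 'I_n -> {vspace B}),
    [/\ forall i, minimal_left_ideal (S i), (\sum_i S i)%VS = I & directv (\sum_i S i)].
  by apply: h; apply: subvf.
have [n] := ubnP (\dim I); elim: n I => // n IH I dI hI.
have [->|I0] := eqVneq I 0%VS.
  by exists 0%N, (fun=> 0%VS); split=> [[]//||]; rewrite ?directvE /= ?big_ord0 ?dimv0.
have [S [hS S0 mS] SI] := minimal_left_ideal_exists hI I0.
have [e eS eE] := left_ideal_idempotent hS proj.
pose J := (I :&: lker (amulr e))%VS.
have JE x : (x \in J) = (x \in I) && (x * e == 0).
  by rewrite memv_cap memv_ker lfunE.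
have hJ : left_ideal J.
  apply/left_idealP => b x; rewrite !JE => /andP[xI /eqP xe].
  by rewrite -mulrA xe mulr0 eqxx andbT; apply: (left_idealP I).1.
have SJ0 : (S :&: J)%VS = 0%VS.
  apply/eqP; rewrite -subv0; apply/subvP => x; rewrite memv_cap JE memv0.
  by move=> /and3P[xS _]; rewrite (eE x xS).
have SJI : (S + J)%VS = I.
  apply/eqP; rewrite eqEsubv subv_add SI capvSl /=; apply/subvP => x xI.
  have xeS : x * e \in S by apply: (left_idealP S).1.
  rewrite -[x](subrK (x * e)) addrC memv_add // JE mulrBl -mulrA (eE e eS) subrr eqxx.
  by rewrite andbT rpredB //; apply: (subvP SI).
have dSJ : \dim I = (\dim S + \dim J)%N by rewrite -SJI dimv_disjoint_sum.
have [|m [T [mT sT dT]]] := IH J _ hJ.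
  rewrite ltnS in dI; apply: leq_trans dI; rewrite dSJ.
  by rewrite -[X in (X < _)%N]add0n ltn_add2r lt0n dimv_eq0.
exists m.+1, (fun i => if unlift ord0 i is Some j then T j else S); split=> [i||].
- by case: unliftP => // j _.
- rewrite big_ord_recl unlift_none -[RHS]SJI -sT; congr (_ + _)%VS.
  by apply: eq_bigr => i _; rewrite liftK.
rewrite directvE /= !big_ord_recl !unlift_none.
under [X in (_ + X)%VS]eq_bigr do rewrite liftK.
under [X in (_ + X)%N]eq_bigr do rewrite liftK.
rewrite sT SJI dSJ; move: dT; rewrite directvE /= sT => /eqP ->.
by rewrite eqxx.
Qed.

(** If all such injections split, a finite resolution would have projective syzygies one after
    another, so every finitely generated module would be projective and [B] semisimple. *)
Lemma nonsplit_injection : finite_gldim B -> ~ semisimple_algebra B ->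
  exists (P1 P0 : lmodType B) (i : {linear P1 -> P0}),
    [/\ dual_basis P1, dual_basis P0, injective i &
        forall r : {linear P0 -> P1}, ~ (forall x, r (i x) = x)].
Proof.
move=> hB ns; apply: contrapT => none; apply: ns; apply: semisimple_of_projective.
move=> M gM; have [d /(_ M gM)[Q Q0]] := hB.
have {}Q0 i : (d.+1 <= i)%N -> forall x : res_obj Q i, x = 0 by apply: Q0.
elim: d.+1 M gM Q Q0 => {d} [|d IH] M gM Q Q0.
  exists 0%N, (fun=> 0), (fun=> \0) => m.
  by rewrite big_ord0; apply: (res_zero (Q0 0%N isT)).
have hK := IH _ (res_fin_gen (shift Q)) (shift Q) (fun i => Q0 i.+1).
have [r rK] : exists r : {linear res_obj Q 0 -> ker (res_aug Q)},
    forall z, r (ker_inc (res_aug Q) z) = z.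
  apply: contrapT => nr; apply: none.
  exists (ker (res_aug Q)), (res_obj Q 0), (ker_inc (res_aug Q)); split=> //.
  - exact: res_dual_basis.
  - exact: ker_inc_inj.
  - by move=> r rK; apply: nr; exists r.
exact: dual_basis_split_quotient rK.
Qed.

End Semisimplicity.

(** * The converse for non-semisimple [B] *)

Section NonSemisimple.
Variables (k : fieldType) (A B : falgType k).
Hypotheses (hB : finite_gldim B) (nsB : ~ semisimple_algebra B).
Local Notation L := (tensalg A B).

Lemma left_weakly_Gorenstein_of_Mon :
  (forall M : lmodType L, semi_Gorenstein_projective M -> monic_rep M) ->
  left_weakly_Gorenstein A.
Proof.
move=> hM; apply/(left_weakly_GorensteinP (finite_falg A)) => N sN n nz.
apply: contrapT => nt.
have f0 (f : {linear N -> A^o}) : f n = 0.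
  by apply: contrapT => /eqP fn; apply: nt; exists f.
have nL := noetherian_finite (finite_tensalg A B).
have [P1 [P0 [i [h1 h0 ii ni]]]] := nonsplit_injection hB nsB.
have s1 := sgp_ntens sN h1; have s0 := sgp_ntens sN h0.
have [ui _ _] : short_exact (nmap (idfun : {linear N -> N}) i) (nmap idfun (coker_proj i)).
  apply: short_exact_ntens (short_exact_coker ii).
  exact: fin_gen_surj (dual_basis_fin_gen h0) (@coker_proj_surj _ _ _ i).
have [r [phi phiP]] := left_approximation (finite_tensalg A B) s1.1.
pose j := pair_lin (nmap idfun i) phi.
have ji : injective j by move=> s t /(congr1 fst); apply: ui.
have ex := short_exact_coker ji.
have sM : semi_Gorenstein_projective (coker j).
  apply: (sgp_quotient nL ex s1).
    exact: (sgp_prod nL s0 (sgp_projective (dual_basis_free L r))).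
  (* The component [phi] of [j] is a left approximation, which supplies the extensions required for
     Ext^1. *)
  move=> f; have [g gP] := phiP f; exists (g \o proj2_lin _ _) => z.
  exact: gP.
have exr : short_exact (restrict_linear (@tensr k A B) j)
  (restrict_linear (@tensr k A B) (coker_proj j)) := ex.
have [_ pM] := hM _ sM.
have [rho [_ [rhoj _ _]]] := short_exact_split exr pM.
(* A nonzero coordinate of [phi (n (x) x)], followed by an [A]-form on Lambda detecting it, would be
   an [A]-map [N -> A] not killing [n]. *)
have phi0 x : phi (npure n x) = 0.
  apply/ffunP => m; rewrite ffunE; apply: contrapT => /eqP nzm.
  have [g gn] := dual_basis_torsionless (dual_basis_tensl A B)
    (nzm : (phi (npure n x) m : restrict (tensl B) L^o) != 0).
  have qL : linear (fun n' => g (phi (npure n' x) m)).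
    move=> a u v; rewrite npureDl -tensl_npure linearD linearZ_LR !ffunE.
    exact: linearP.
  by have := f0 (mk_linear qL); move: gn => /[swap] /= ->; rewrite eqxx.
have [l ln] := linear_form sN.1 nz.
(* After this normalization the contraction [h] sends [n (x) x] to [x]. *)
have lL : linear (fun u => (l n)^-1 * l u : k^o).
  by move=> c u v; rewrite linearP mulrDr; congr (_ + _); apply: mulrCA.
have [h hE] := ncontract P1 (mk_linear lL).
(* The [B]-retraction [rho] of [j] is restricted to [n (x) P0] and contracted. As [phi] vanishes on
   [n (x) P1], the pair [(n (x) i x, 0)] is [j (n (x) x)], so the result retracts [i]. *)
have RL : linear (fun y => h (rho (npure n y, 0 : free L r))).
  move=> b y y'; rewrite npureDr -tensr_npure -linearP -linearP; congr (h (rho _)).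
  by apply: injective_projections => //=; rewrite addr0; apply/esym/scaler0.
apply: (ni (mk_linear RL)) => x /=.
have -> : (npure n (i x), 0) = j (npure n x) by rewrite /= nmapE phi0.
by rewrite rhoj hE /= mulVf // scale1r scale1r.
Qed.

End NonSemisimple.

Theorem theorem1p2 (k : fieldType) (A B : falgType k) (hB : finite_gldim B) :
  [/\ left_weakly_Gorenstein (tensalg A B) <-> left_weakly_Gorenstein A,
      left_weakly_Gorenstein A ->
        forall M : lmodType (tensalg A B),
          semi_Gorenstein_projective M <-> Mon (@semi_Gorenstein_projective A) M &
      ~ semisimple_algebra B ->
        (forall M : lmodType (tensalg A B),
          semi_Gorenstein_projective M <-> Mon (@semi_Gorenstein_projective A) M) ->
        left_weakly_Gorenstein A].
Proof.
split.
- split; first exact: left_weakly_Gorenstein_factor.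
  exact: left_weakly_Gorenstein_tensalg.
- exact: sgp_Mon.
move=> nsB hM; apply: left_weakly_Gorenstein_of_Mon hB nsB _ => M /hM[].
by [].
Qed.
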